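(* Let $f(x)=\frac{1}{Mn}\sum_{m\in[M],j\in[n]}f_{m,j}(x)$, and let $\mathcal{K}\subseteq\mathbb{R}^d$ be convex and compact with diameter $D=\sup_{x,y\in\mathcal{K}}\|x-y\|$. Assume all $f_{m,j}$ are (possibly non-convex) $L$-smooth on $\mathcal{K}$, $\sup_{x\in\mathcal{K}}|f_{m,j}(x)|\le M_0$, and $\|\nabla f_{m,j}(x)\|_\infty\le G_\infty$ for all $x\in\mathcal{K}$, $m\in[M]$, $j\in[n]$. Run the Quantized Frank-Wolfe (QFW) algorithm described in the context for $T$ rounds from $x_1\in\mathcal{K}$ with: $p_i=\sqrt n$; $\mathcal{S}_{i,1}^m=\{f_{m,j}:j\in[n]\}$ (each worker uses all its $n$ functions when $k=1$); $S_{i,k}=\sqrt n/M$ for $i\ge1,k\ge2$; $\eta_t=T^{-1/2}$ for all $t$; and the $s$-Partition Encoding Scheme with levels $s_{1,i,1}=\sqrt{Td/M}$, $s_{2,i,1}=\sqrt{Td}$ for $k=1$, and $s_{1,i,k}=\frac{d^{1/2}n^{1/4}}{\sqrt M}$, $s_{2,i,k}=d^{1/2}n^{1/4}$ for $k\ge2$. Let $x_o$ be chosen uniformly at random from $\{x_1,\dots,x_T\}$. Then $x_o\in\mathcal{K}$ and $$\mathbb{E}[\mathcal{G}(x_o)]\le\frac{2M_0+D\sqrt{3L^2D^2+2G_\infty^2}+\frac{LD^2}{2}}{\sqrt T},$$ where $\mathcal{G}(x)=\max_{v\in\mathcal{K}}\langle v-x,-\nabla f(x)\rangle$ is the Frank-Wolfe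 gap.
   Context: $\|\cdot\|$ is the Euclidean norm, $[n]=\{1,\dots,n\}$. There are $M$ workers and a master; $N=Mn$ is the total number of component functions and worker $m$ has access to the functions $f_{m,j}$, $j\in[n]$. A function is $L$-smooth on $\mathcal{K}$ if its gradient is $L$-Lipschitz on $\mathcal{K}$. $s$-Partition Encoding Scheme: for $g\in\mathbb{R}^d$ and each coordinate $i$, find $l_i\in\{0,\dots,s-1\}$ with $|g_i|/\|g\|_\infty\in[l_i/s,(l_i+1)/s]$ and let $b_i=l_i/s$ with probability $1-\frac{|g_i|}{\|g\|_\infty}s+l_i$, and $b_i=(l_i+1)/s$ with probability $\frac{|g_i|}{\|g\|_\infty}s-l_i$. The transmitted data are $\mathrm{sign}(g_i)b_i$ and $\|g\|_\infty$; the decoded vector $\phi'(g)$ has coordinates $\mathrm{sign}(g_i)b_i\|g\|_\infty$. QFW: rounds $t=1,\dots,T$ are grouped in consecutive periods of lengths $p_1,p_2,\dots$; round $t$ corresponds to $(i,k)$ with $t=\sum_{j=1}^{i-1}p_j+k$, $1\le k\le p_i$, and $x_{i,k}=x_t$, $\eta_{i,k}=\eta_t$. In round $(i,k)$ each worker $m$ takes a collection $\mathcal{S}_{i,k}^m$ of its local functions; for $k\ge2$ it is a set of $S_{i,k}$ local functions sampled uniformly at random. Writing $f_{\mathcal{S}}$ for the average of the functions in $\mathcal{S}$, the worker computes $g_{i,1}^m=\nabla f_{\mathcal{S}_{i,1}^m}(x_t)$ if $k=1$, and $g_{i,k}^m=\nabla f_{\mathcal{S}_{i,k}^m}(x_t)-\nabla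 f_{\mathcal{S}_{i,k}^m}(x_{t-1})$ if $k\ge2$, and sends it encoded with level $s_{1,i,k}$. The master decodes these to $\Phi_{1,i,k}'(g_{i,k}^m)$, forms $\tilde g_{i,k}=\frac1M\sum_{m=1}^M\Phi_{1,i,k}'(g_{i,k}^m)$, and broadcasts it encoded with level $s_{2,i,k}$; workers decode it to $\Phi_{2,i,k}'(\tilde g_{i,k})$ and set $\bar g_{i,1}=\Phi_{2,i,1}'(\tilde g_{i,1})$ if $k=1$, $\bar g_{i,k}=\Phi_{2,i,k}'(\tilde g_{i,k})+\bar g_{i,k-1}$ if $k\ge2$. Then $v_{i,k}\in\arg\min_{v\in\mathcal{K}}\langle v,\bar g_{i,k}\rangle$ and $x_{t+1}=x_t+\eta_{i,k}(v_{i,k}-x_t)$. The random choices of different workers and rounds are made independently. *)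

(* Defs.v *)
From HB Require Import structures.
From mathcomp Require Import all_boot all_order all_algebra.
From mathcomp Require Import all_classical all_reals all_analysis.

Set Implicit Arguments.
Unset Strict Implicit.
Unset Printing Implicit Defensive.

Import Order.TTheory GRing.Theory Num.Theory.
Import numFieldNormedType.Exports.

Local Open Scope classical_set_scope.
Local Open Scope ring_scope.

(* The library norm `|u| on 'rV[R]_d is the sup norm, so it is used as it is for
   the infinity norm; the Euclidean norm is enorm.  The topology of 'rV[R]_d
   (compactness, differentiability) is the same for both. *)

Definition dotp (R : realType) (d : nat) (u v : 'rV[R]_d) : R :=
  \sum_(i < d) u 0 i * v 0 i.

Definition enorm (R : realType) (d : nat) (u : 'rV[R]_d) : R :=
  Num.sqrt (dotp u u).

Definition grad (R : realType) (d : nat) (h : 'rV[R]_d -> R) (x : 'rV[R]_d) :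
    'rV[R]_d :=
  \row_(i < d) 'D_(delta_mx 0 i) h x.

Definition diameter (R : realType) (d : nat) (K : set 'rV[R]_d) : R :=
  sup [set enorm (z.1 - z.2) | z in K `*` K].

(* The differential at a point of K, including a boundary point, is the one of
   the function h on the whole space. *)
Definition smooth_on (R : realType) (d : nat) (K : set 'rV[R]_d) (L : R)
    (h : 'rV[R]_d -> R) : Prop :=
  (forall x, K x -> differentiable h x) /\
  (forall x y, K x -> K y -> enorm (grad h x - grad h y) <= L * enorm (x - y)).

Definition average (R : realType) (d n : nat) (A : {set 'I_n})
    (h : 'I_n -> 'rV[R]_d -> R) (x : 'rV[R]_d) : R :=
  #|A|%:R^-1 * \sum_(j in A) h j x.

Definition objective (R : realType) (d M n : nat)
    (f : 'I_M -> 'I_n -> 'rV[R]_d -> R) (x : 'rV[R]_d) : R :=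
  (M * n)%:R^-1 * \sum_(m < M) \sum_(j < n) f m j x.

Definition fw_gap (R : realType) (d : nat) (K : set 'rV[R]_d)
    (h : 'rV[R]_d -> R) (x : 'rV[R]_d) : R :=
  sup [set dotp (v - x) (- grad h x) | v in K].

(* s-partition encoding.  The only randomness of the encoder is, for each
   coordinate i, a bit telling whether |g_i| / |g|_oo is rounded up to
   (l_i + 1) / s or down to l_i / s. *)

(* The choice of l is ambiguous only if r = l / s with 0 < l < s; the law of the
   rounded value is then the point mass at r for both choices. *)
Definition partition_level (R : realType) (s : nat) (r : R) : nat :=
  if [pick l : 'I_s | l%:R / s%:R <= r <= l.+1%:R / s%:R] is Some l then l
  else 0%N.

Definition enc_ratio (R : realType) (d : nat) (g : 'rV[R]_d) (i : 'I_d) : R :=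
  `|g 0 i| / `|g|.

Definition enc_level (R : realType) (d : nat) (s : nat) (g : 'rV[R]_d)
    (i : 'I_d) : nat :=
  partition_level s (enc_ratio g i).

Definition up_prob (R : realType) (d : nat) (s : nat) (g : 'rV[R]_d)
    (i : 'I_d) : R :=
  enc_ratio g i * s%:R - (enc_level s g i)%:R.

Definition enc_value (R : realType) (d : nat) (s : nat) (g : 'rV[R]_d)
    (up : {ffun 'I_d -> bool}) (i : 'I_d) : R :=
  (if up i then (enc_level s g i).+1%:R else (enc_level s g i)%:R) / s%:R.

Definition decoded (R : realType) (d : nat) (s : nat) (g : 'rV[R]_d)
    (up : {ffun 'I_d -> bool}) : 'rV[R]_d :=
  \row_(i < d) (Num.sg (g 0 i) * enc_value s g up i * `|g|).

(* Rounds, periods and positions inside a period are all numbered from 0: round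
   t here is round t + 1 of the usual numbering, and round_index p t = (i, k)
   is the pair (i + 1, k + 1) there. *)
Fixpoint round_index (p : nat -> nat) (t : nat) : nat * nat :=
  if t is u.+1 then
    let: (i, k) := round_index p u in
    if (k.+1 < p i)%N then (i, k.+1) else (i.+1, 0%N)
  else (0%N, 0%N).

(* The functions with two arguments are indexed by (i, k), step_size by the
   round. *)
Record qfw_params (R : realType) := QfwParams {
  period : nat -> nat;
  sample_size : nat -> nat -> nat;
  level1 : nat -> nat -> nat;
  level2 : nat -> nat -> nat;
  step_size : nat -> R
}.

Record qfw_choices (d M n : nat) (Omega : Type) := QfwChoices {
  sample : nat -> 'I_M -> Omega -> {set 'I_n};
  up1 : nat -> 'I_M -> Omega -> {ffun 'I_d -> bool};
  up2 : nat -> Omega -> {ffun 'I_d -> bool}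
}.

(* gloc t m is g^m, gavg t is the average formed by the master, gbar t the
   workers' gradient estimator, lmo t the Frank-Wolfe vertex v. *)
Record qfw_process (R : realType) (d M : nat) (Omega : Type) := QfwProcess {
  gloc : nat -> 'I_M -> Omega -> 'rV[R]_d;
  gavg : nat -> Omega -> 'rV[R]_d;
  gbar : nat -> Omega -> 'rV[R]_d;
  lmo : nat -> Omega -> 'rV[R]_d;
  iter_pt : nat -> Omega -> 'rV[R]_d
}.

(* The outcomes that agree with w0 on all the choices of the rounds before t. *)
Definition past (d M n : nat) (Omega : Type) (c : qfw_choices d M n Omega)
    (t : nat) (w0 : Omega) : set Omega :=
  [set w | forall u, (u < t)%N ->
     (forall m, sample c u m w = sample c u m w0 /\ up1 c u m w = up1 c u m w0)
     /\ up2 c u w = up2 c u w0].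

(* Any selection in the argmin is allowed, provided that it depends only on the
   random choices made so far (qfw_lmo_adapted). *)
Record qfw_run (R : realType) (d M n : nat) (Omega : Type)
    (prm : qfw_params R) (K : set 'rV[R]_d)
    (f : 'I_M -> 'I_n -> 'rV[R]_d -> R) (T : nat) (x1 : 'rV[R]_d)
    (c : qfw_choices d M n Omega) (q : qfw_process R d M Omega) : Prop := QfwRun {
  qfw_init : forall w, iter_pt q 0 w = x1;
  qfw_gloc : forall t m w, (t < T)%N ->
    let: (i, k) := round_index (period prm) t in
    let fS := average (sample c t m w) (f m) in
    gloc q t m w =
      if k == 0%N then grad fS (iter_pt q t w)
      else grad fS (iter_pt q t w) - grad fS (iter_pt q t.-1 w);
  qfw_gavg : forall t w, (t < T)%N ->
    let: (i, k) := round_index (period prm) t in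
    gavg q t w =
      M%:R^-1 *: \sum_(m < M) decoded (level1 prm i k) (gloc q t m w) (up1 c t m w);
  qfw_gbar : forall t w, (t < T)%N ->
    let: (i, k) := round_index (period prm) t in
    let Phi2 := decoded (level2 prm i k) (gavg q t w) (up2 c t w) in
    gbar q t w = if k == 0%N then Phi2 else Phi2 + gbar q t.-1 w;
  qfw_lmo_in : forall t w, (t < T)%N -> K (lmo q t w);
  qfw_lmo_min : forall t w u, (t < T)%N -> K u ->
    dotp (lmo q t w) (gbar q t w) <= dotp u (gbar q t w);
  qfw_lmo_adapted : forall t w0 w, (t < T)%N ->
    past c t.+1 w0 w -> lmo q t w = lmo q t w0;
  qfw_step : forall t w, (t < T)%N ->
    iter_pt q t.+1 w =
      iter_pt q t w + step_size prm t *: (lmo q t w - iter_pt q t w)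
}.

Definition cond_pr (R : realType) (disp : measure_display)
    (Omega : measurableType disp) (P : probability Omega R)
    (A B : set Omega) : R :=
  fine (P (A `&` B)) / fine (P A).

Definition discrete_rv (disp : measure_display) (Omega : measurableType disp)
    (C : finType) (X : Omega -> C) : Prop :=
  forall a, measurable (X @^-1` [set a]).

(* The law of the random choices, round by round, given the outcome w0 of the
   previous choices.  Only the marginals of the rounding bits of one encoded
   vector are prescribed: their joint law across the coordinates is free. *)
Record qfw_law (R : realType) (d M n : nat) (disp : measure_display)
    (Omega : measurableType disp) (P : probability Omega R)
    (prm : qfw_params R) (T : nat)
    (c : qfw_choices d M n Omega) (q : qfw_process R d M Omega) : Prop := QfwLaw {
  qfw_sample_rv : forall t m, (t < T)%N -> discrete_rv (sample c t m);
  qfw_up1_rv : forall t m, (t < T)%N -> discrete_rv (up1 c t m);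
  qfw_up2_rv : forall t, (t < T)%N -> discrete_rv (up2 c t);
  qfw_workers_indep : forall t w0
      (S : 'I_M -> {set 'I_n}) (b : 'I_M -> {ffun 'I_d -> bool}), (t < T)%N ->
    P (past c t w0) != 0%E ->
    cond_pr P (past c t w0)
        [set w | forall m, sample c t m w = S m /\ up1 c t m w = b m] =
      \prod_(m < M) cond_pr P (past c t w0)
        [set w | sample c t m w = S m /\ up1 c t m w = b m];
  qfw_sample_uniform : forall t m w0 (S : {set 'I_n}), (t < T)%N ->
    let: (i, k) := round_index (period prm) t in
    (0 < k)%N -> P (past c t w0) != 0%E ->
    cond_pr P (past c t w0) [set w | sample c t m w = S] =
      if #|S| == sample_size prm i k then 'C(n, sample_size prm i k)%:R^-1 else 0;
  qfw_up1_law : forall t m w0 (a : 'I_d), (t < T)%N ->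
    let: (i, k) := round_index (period prm) t in
    let A := past c t w0 `&` [set w | sample c t m w = sample c t m w0] in
    P A != 0%E ->
    cond_pr P A [set w | up1 c t m w a] =
      up_prob (level1 prm i k) (gloc q t m w0) a;
  qfw_up2_law : forall t w0 (a : 'I_d), (t < T)%N ->
    let: (i, k) := round_index (period prm) t in
    let A := past c t w0 `&` [set w | forall m,
      sample c t m w = sample c t m w0 /\ up1 c t m w = up1 c t m w0] in
    P A != 0%E ->
    cond_pr P A [set w | up2 c t w a] =
      up_prob (level2 prm i k) (gavg q t w0) a
}.

(* o is uniform on the T rounds and independent of all the choices of the run. *)
Definition uniform_index (R : realType) (d M n : nat) (disp : measure_display)
    (Omega : measurableType disp) (P : probability Omega R) (T : nat)
    (c : qfw_choices d M n Omega) (o : Omega -> 'I_T) : Prop :=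
  discrete_rv o /\
  forall w0 (j : 'I_T), P (past c T w0) != 0%E ->
    cond_pr P (past c T w0) [set w | o w = j] = T%:R^-1.

(* Main.v *)
Require Import Defs.
From HB Require Import structures.
From mathcomp Require Import all_boot all_order all_algebra.
From mathcomp Require Import all_classical all_reals all_analysis.
From mathcomp Require Import perm ring lra.

Set Implicit Arguments.
Unset Strict Implicit.
Unset Printing Implicit Defensive.

Import Order.TTheory GRing.Theory Num.Theory.
Import numFieldNormedType.Exports.

Local Open Scope classical_set_scope.
Local Open Scope ring_scope.

(** Let e_t be the difference between the gradient estimator of round t and
    the gradient of the objective at x_t.  Two estimates are combined.

    Optimization, for each outcome separately.  Since the vertex v_t minimizes
    its product with the estimator rather than with the gradient, the
    Frank-Wolfe gap at x_t is at most <x_t - v_t, grad> + D |e_t|; since the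
    objective lies below its quadratic upper model on the convex set K, the
    first term is paid for by the decrease of the objective, up to
    L D^2 eta / 2 (fw_progress).  Summing over the rounds, the decreases
    telescope to at most 2 M0 (gap_sum), and it remains to bound the mean of
    |e_t|.

    Variance.  Within a period the error obeys e_t = e_(t-1) + xi_t, where
    xi_t collects three perturbations, each with mean zero given what precedes
    it: the subsampling of each worker, the rounding done by each worker, and
    the rounding done by the master; at the head of a period e_t = xi_t.  Hence
    second moments add up.  Rounding a vector g at s levels costs at most
    (|g|_oo / s)^2 per coordinate (mean_quantize), drawing s functions out of n
    without replacement costs at most 1 / s times the mean square
    (sampling_variance), and averaging M independent centred worker errors
    divides the variance by M (mean_indep_average).  The vectors encoded inside
    a period are differences of gradients at consecutive iterates, so they have
    size at most |L| D / sqrt T.  With the prescribed levels a period head costs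
    2 Ginf^2 / T (first_period_error), each later round costs
    3 L^2 D^2 / (T sqrt n) (late_error), and a period has sqrt n rounds; so
    E |e_t|^2 is at most (3 L^2 D^2 + 2 Ginf^2) / T for every t.  Jensen's
    inequality then bounds the mean of |e_t|.

    All of this happens on a finite probability space: only finitely many
    choices with finitely many values are made.  The functional mean below is
    the expectation over that space, restricted to an event.  It is linear on
    all functions, and conditioning on the past amounts to splitting the event
    along the values of a finite-valued function (mean_partition). *)

(** * Expectation over finitely many outcomes *)

Section FiniteExpectation.
Variables (R : realType) (disp : measure_display) (Omega : measurableType disp).
Variables (P : probability Omega R) (C : finType) (Z : Omega -> C) (w0 : Omega).

(** The default w0 only serves the values that Z does not take. *)
Definition atom_rep (a : C) : Omega := xget w0 (Z @^-1` [set a]).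

(** The unnormalized expectation of X on the event A: for A and X that depend
    on the outcome through Z only, it is the integral of X over A.  Evaluating X
    at one representative of each atom makes it linear in X without any
    measurability condition. *)
Definition mean (A : set Omega) (X : Omega -> R) : R :=
  \sum_(a | `[< A (atom_rep a) >]) fine (P (Z @^-1` [set a])) * X (atom_rep a).

Definition determined (A : set Omega) : Prop :=
  forall w w', Z w = Z w' -> A w -> A w'.

Implicit Types (A B : set Omega) (X Y : Omega -> R).

Lemma atom_pr_ge0 a : 0 <= fine (P (Z @^-1` [set a])).
Proof. exact: fine_ge0. Qed.

Lemma Z_atom_rep w : Z (atom_rep (Z w)) = Z w.
Proof. by rewrite /atom_rep; case: xgetP => [x _ //|/(_ w)] /=. Qed.

Lemma eq_mean A X Y : (forall w, A w -> X w = Y w) -> mean A X = mean A Y.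
Proof. by move=> XY; apply: eq_bigr => a /asboolP Aa; rewrite XY. Qed.

Lemma ler_mean A X Y : (forall w, A w -> X w <= Y w) -> mean A X <= mean A Y.
Proof.
move=> XY; apply: ler_sum => a /asboolP Aa.
by rewrite ler_wpM2l ?atom_pr_ge0 ?XY.
Qed.

Lemma meanD A X Y : mean A (fun w => X w + Y w) = mean A X + mean A Y.
Proof. by rewrite -big_split; apply: eq_bigr => a _; rewrite mulrDr. Qed.

Lemma meanZ A k X : mean A (fun w => k * X w) = k * mean A X.
Proof. by rewrite big_distrr; apply: eq_bigr => a _; rewrite mulrCA. Qed.

Lemma mean_cst A k : mean A (fun=> k) = k * mean A (fun=> 1).
Proof. by rewrite -meanZ; apply: eq_mean => w _; rewrite mulr1. Qed.

Lemma mean_sum (I : finType) A (X : I -> Omega -> R) :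
  mean A (fun w => \sum_i X i w) = \sum_i mean A (X i).
Proof.
by rewrite exchange_big; apply: eq_bigr => a _; rewrite big_distrr.
Qed.

Lemma mean_ge0 A X : (forall w, A w -> 0 <= X w) -> 0 <= mean A X.
Proof.
move=> X0; apply: sumr_ge0 => a /asboolP Aa.
by rewrite mulr_ge0 ?atom_pr_ge0 ?X0.
Qed.

(** All atoms in A have weight zero then. *)
Lemma mean_null A X : mean A (fun=> 1) = 0 -> mean A X = 0.
Proof.
move=> A0; apply: big1 => a Aa.
have /eqP := A0; rewrite psumr_eq0 => [/allP/(_ a)|b _]; last first.
  by rewrite mulr1 atom_pr_ge0.
rewrite mem_index_enum mulr1 Aa /= => /(_ isT)/eqP ->.
by rewrite mul0r.
Qed.

(** The law of total expectation. *)
Lemma mean_partition (I : finType) (F : Omega -> I) A X :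
  mean A X = \sum_i mean (A `&` F @^-1` [set i]) X.
Proof.
rewrite /mean (partition_big (fun a => F (atom_rep a)) predT) //=.
apply: eq_bigr => i _; apply: eq_bigl => a.
apply/andP/asboolP => [[/asboolP Aa /eqP Fa]|[Aa /= Fa]] //.
by split; [exact/asboolP|exact/eqP].
Qed.

Lemma mean_indic A (b : Omega -> bool) X :
  mean A (fun w => (b w)%:R * X w) = mean (A `&` [set w | b w]) X.
Proof.
rewrite /mean [LHS](bigID (fun a => b (atom_rep a))) /= addrC big1 ?add0r.
  apply: eq_big => [a|a /andP[_ ->]]; last by rewrite mul1r.
  by apply/andP/asboolP => [[/asboolP]|[/asboolP]].
by move=> a /andP[_ /negPf ->]; rewrite mul0r mulr0.
Qed.

Hypothesis Z_rv : discrete_rv Z.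

Lemma determined_measurable A : determined A -> measurable A.
Proof.
move=> dA.
have -> : A = \bigcup_(a in [set a | A (atom_rep a)]) (Z @^-1` [set a]).
  apply/seteqP; split=> [w Aw|w [a Aa /= Zw]].
    by exists (Z w) => //=; apply: dA Aw; rewrite Z_atom_rep.
  by apply: dA Aa; rewrite -Zw Z_atom_rep.
by apply: fin_bigcup_measurable => [|a _]; [exact: finite_finset|exact: Z_rv].
Qed.

(** A function of Z is a finite combination of indicators of the atoms. *)
Lemma expectation_mean X : (forall w w', Z w = Z w' -> X w = X w') ->
  ('E_P[X] = (mean setT X)%:E)%E.
Proof.
move=> XZ; rewrite unlock.
under eq_integral => w _.
  have -> : X w = \sum_a X (atom_rep a) * \1_(Z @^-1` [set a]) w.
    rewrite (bigD1 (Z w)) //= big1 ?addr0 => [|a aZ].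
      rewrite indicE mem_set //= mulr1; apply: XZ; by rewrite Z_atom_rep.
    rewrite indicE memNset ?mulr0 //= => Zw; by rewrite Zw eqxx in aZ.
  rewrite -sumEFin; under eq_bigr do rewrite EFinM.
  over.
have indic_int a : P.-integrable setT (EFin \o \1_(Z @^-1` [set a])).
  exact/integrable_indic/Z_rv.
rewrite integral_sum //= => [|a]; last first.
  exact: integrableZl _ (indic_int a).
rewrite /mean -sumEFin; apply: eq_big => [a|a _].
  by apply/esym/asboolP.
rewrite integralZl //=; last exact: indic_int.
rewrite integral_indic ?setIT //.
by rewrite muleC EFinM fineK // fin_num_measure //; exact: Z_rv.
Qed.

Lemma mean_one A : determined A -> mean A (fun=> 1) = fine (P A).
Proof.
move=> dA; have mA := determined_measurable dA.
have := expectation_mean (X := \1_A); rewrite expectation_indic // => -> /=.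
  have -> : mean A (fun=> 1) = mean (setT `&` [set w | w \in A]) (fun=> 1).
    by congr mean; apply/seteqP; split=> w; rewrite /= inE //; case.
  by rewrite -mean_indic; apply: eq_mean => w _; rewrite indicE mulr1.
move=> w w' Zw; rewrite !indicE; congr (nat_of_bool _)%:R.
by apply/idP/idP => /set_mem Aw; apply/mem_set; apply: dA Aw.
Qed.

Lemma determinedI A B : determined A -> determined B -> determined (A `&` B).
Proof. by move=> dA dB w w' Zw [Aw Bw]; split; [exact: dA Aw|exact: dB Bw]. Qed.

(** The bridge from conditional probabilities to restricted means; if A has
    probability zero, both sides vanish. *)
Lemma mean_cond A B : determined A -> determined B ->
  mean (A `&` B) (fun=> 1) = cond_pr P A B * mean A (fun=> 1).
Proof.
move=> dA dB; have mA := determined_measurable dA.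
have dAB := determinedI dA dB; have mAB := determined_measurable dAB.
rewrite !mean_one // /cond_pr.
have [PA0|PA0] := eqVneq (fine (P A)) 0; last by rewrite divfK.
have PA : P A = 0%E by rewrite -[P A]fineK ?fin_num_measure // PA0.
rewrite PA0 mulr0 (_ : P (A `&` B) = 0%E) //.
by apply: subset_measure0 PA => //; exact: subIsetl.
Qed.

Lemma mean_mass1 : mean setT (fun=> 1) = 1.
Proof. by rewrite mean_one // probability_setT. Qed.

(** Jensen's inequality, from the nonnegativity of the variance of X. *)
Lemma mean_le_sqrt X v : mean setT (fun w => X w ^+ 2) <= v ->
  mean setT X <= Num.sqrt v.
Proof.
move=> Xv; set m := mean setT X.
have : 0 <= mean setT (fun w => (X w - m) ^+ 2).
  by apply: mean_ge0 => w _; exact: sqr_ge0.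
have -> : mean setT (fun w => (X w - m) ^+ 2) =
    mean setT (fun w => X w ^+ 2 + ((- 2 * m) * X w + m ^+ 2)).
  by apply: eq_mean => w _; ring.
rewrite !meanD meanZ mean_cst mean_mass1 -/m => v0.
have mv : m ^+ 2 <= v by lra.
by rewrite (le_trans (ler_norm m)) // -sqrtr_sqr ler_wsqrtr.
Qed.

End FiniteExpectation.

Arguments eq_mean {R disp Omega P C Z w0 A X} Y _.
Arguments mean_cst {R disp Omega P C Z w0} A k.
Arguments mean_partition {R disp Omega P C Z w0 I} F A X.
Arguments mean_indic {R disp Omega P C Z w0} A b X.

Lemma discrete_rv_pair disp (Omega : measurableType disp) (C D : finType)
    (X : Omega -> C) (Y : Omega -> D) :
  discrete_rv X -> discrete_rv Y -> discrete_rv (fun w => (X w, Y w)).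
Proof.
move=> X_rv Y_rv [a b].
have -> : (fun w => (X w, Y w)) @^-1` [set (a, b)] =
    X @^-1` [set a] `&` Y @^-1` [set b].
  by apply/seteqP; split=> w /= [-> ->].
by apply: measurableI; [exact: X_rv|exact: Y_rv].
Qed.

Lemma discrete_rv_ffun disp (Omega : measurableType disp) (I C : finType)
    (X : I -> Omega -> C) :
  (forall i, discrete_rv (X i)) -> discrete_rv (fun w => [ffun i => X i w]).
Proof.
move=> X_rv a.
have -> : (fun w => [ffun i => X i w]) @^-1` [set a] =
    \bigcap_(i in [set: I]) (X i @^-1` [set a i]).
  apply/seteqP; split=> [w /= Xw i _ /=|w Xw]; first by rewrite -Xw ffunE.
  by apply/ffunP => i; rewrite ffunE; exact: (Xw i).
by apply: fin_bigcap_measurable => [|i _]; [exact: finite_finset|exact: X_rv].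
Qed.

(** * Stochastic rounding *)

Lemma coord_le_norm (R : realType) (d : nat) (g : 'rV[R]_d) i :
  `|g 0 i| <= `|g|.
Proof.
rewrite [leRHS]/Num.norm /= mx_normrE.
exact: (le_bigmax _ (fun ij : 'I_1 * 'I_d => `|g ij.1 ij.2|) (0, i)).
Qed.

Lemma norm_le_coord (R : realType) (d : nat) (g : 'rV[R]_d) (B : R) : 0 <= B ->
  (forall i, `|g 0 i| <= B) -> `|g| <= B.
Proof.
move=> B0 gB; rewrite [leLHS]/Num.norm /= mx_normrE.
by apply: bigmax_le => // -[i j] _; rewrite ord1 gB.
Qed.

(** For empty A the average is 0, by the convention on the inverse of 0. *)
Lemma average_norm (R : realType) (d : nat) (I : finType) (A : {pred I})
    (u : I -> 'rV[R]_d) (B : R) : 0 <= B -> (forall i, `|u i| <= B) ->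
  `|#|A|%:R^-1 *: \sum_(i in A) u i| <= B.
Proof.
move=> B0 uB; rewrite normrZ normfV normr_nat.
have [->|A0] := eqVneq #|A| 0%N; first by rewrite invr0 mul0r.
rewrite ler_pdivrMl ?ltr0n ?lt0n // (le_trans (ler_norm_sum _ _ _)) //.
by rewrite mulr_natl -sumr_const; exact: ler_sum.
Qed.

Lemma coordB (R : realType) (d : nat) (u v : 'rV[R]_d) a :
  (u - v) 0 a = u 0 a - v 0 a.
Proof. by rewrite !mxE. Qed.

Section Quantizer.
Variables (R : realType) (d s : nat).
Hypothesis s_gt0 : (0 < s)%N.
Implicit Types (g : 'rV[R]_d) (i : 'I_d) (b : {ffun 'I_d -> bool}).

Let s0 : 0 < s%:R :> R. Proof. by rewrite ltr0n. Qed.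

(** A cell containing r exists: among the positive k with r <= k / s, the
    smallest one is the right end of such a cell. *)
Lemma partition_levelP (r : R) : 0 <= r <= 1 -> (partition_level s r < s)%N /\
  (partition_level s r)%:R / s%:R <= r <= (partition_level s r).+1%:R / s%:R.
Proof.
move=> /andP[r0 r1].
have cell k : (0 < k)%N -> r <= k%:R / s%:R ->
    exists2 l, (l < k)%N & l%:R / s%:R <= r <= l.+1%:R / s%:R.
  elim: k => // -[_ _ rk|k IHk _ rk]; first by exists 0%N => //; rewrite mul0r r0.
  have [|kr] := leP r (k.+1%:R / s%:R).
    by move/IHk => [//|l lk rl]; exists l => //; apply: leq_trans lk _.
  by exists k.+1 => //; rewrite (ltW kr).
have [|l ls rl] := cell s s_gt0; first by rewrite divff // gt_eqF.
rewrite /partition_level; case: pickP => [//|/(_ (Ordinal ls))].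
by rewrite /= rl.
Qed.

Lemma enc_ratio01 g i : 0 <= enc_ratio g i <= 1.
Proof.
rewrite /enc_ratio divr_ge0 //=.
have [->|g0] := eqVneq `|g| 0; first by rewrite invr0 mulr0.
by rewrite ler_pdivrMr ?mul1r ?coord_le_norm // lt_def g0 /=.
Qed.

Lemma up_prob01 g i : 0 <= up_prob s g i <= 1.
Proof.
have [_] := partition_levelP (enc_ratio01 g i).
rewrite /up_prob /enc_level ler_pdivrMr // ler_pdivlMr // -natr1.
by move=> /andP[lo hi]; apply/andP; split; lra.
Qed.

(** If the norm of g is 0, the ratio is the junk value 0 and so is the
    coordinate. *)
Lemma coord_enc_ratio g i : g 0 i = Num.sg (g 0 i) * enc_ratio g i * `|g|.
Proof.
rewrite /enc_ratio; have [g0|g0] := eqVneq `|g| 0.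
  rewrite g0 mulr0; apply/eqP; rewrite -normr_le0 -g0; exact: coord_le_norm.
by rewrite -mulrA divfK // -numEsg.
Qed.

(** The rounding error of a coordinate is a centred Bernoulli variable scaled
    by the mesh |g| / s; unbiasedness and the variance bound both follow. *)
Lemma decodedB g b i : decoded s g b 0 i - g 0 i =
  ((b i)%:R - up_prob s g i) * (Num.sg (g 0 i) * `|g| / s%:R).
Proof.
rewrite [X in _ - X]coord_enc_ratio mxE /enc_value /up_prob.
have s_neq0 : s%:R != 0 :> R by rewrite gt_eqF.
by case: (b i) => /=; rewrite -?[(enc_level s g i).+1%:R]natr1; field.
Qed.

(** Rounding up never leaves the last cell, so no entry exceeds |g|. *)
Lemma decoded_norm g b : `|decoded s g b| <= `|g|.
Proof.
apply: norm_le_coord => // i; rewrite mxE !normrM (@ger0_norm _ `|g|) //.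
rewrite ler_piMl // mulr_ile1 //; first by rewrite normr_sg lern1 leq_b1.
have [ls _] := partition_levelP (enc_ratio01 g i).
rewrite normfV normr_nat ger0_norm /enc_level; last by case: ifP.
by rewrite ler_pdivrMr // mul1r; case: ifP; rewrite ler_nat // ltnW.
Qed.

End Quantizer.

(** * Second moments by successive conditioning *)

Section Conditioning.
Variables (R : realType) (disp : measure_display) (Omega : measurableType disp).
Variables (P : probability Omega R) (C : finType) (Z : Omega -> C) (w0 : Omega).

Local Notation E := (mean P Z w0).

(** F gathers the information on which the encoded vector g and the quantity h
    depend.  Given F, the rounding error is a centred Bernoulli variable scaled
    by at most B / s: it keeps the mean of h and is uncorrelated with h. *)
Lemma mean_quantize (I : finType) (F : Omega -> I) (A : set Omega) (d s : nat)
    (g : Omega -> 'rV[R]_d) (U : Omega -> {ffun 'I_d -> bool}) (a : 'I_d)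
    (h : Omega -> R) (B : R) : (0 < s)%N ->
  (forall w w', A w -> A w' -> F w = F w' -> g w = g w' /\ h w = h w') ->
  (forall w, A w -> let Q := A `&` F @^-1` [set F w] in
    E (Q `&` [set w' | U w' a]) (fun=> 1) =
      up_prob s (g w) a * E Q (fun=> 1)) ->
  (forall w, A w -> `|g w| <= B) ->
  let X w := decoded s (g w) (U w) 0 a - g w 0 a + h w in
  E A X = E A h /\
  E A (fun w => X w ^+ 2) <=
    E A (fun w => h w ^+ 2) + (B / s%:R) ^+ 2 * E A (fun=> 1).
Proof.
move=> s0 ghF Ulaw gB X.
suff cell i : let Q := A `&` F @^-1` [set i] in E Q X = E Q h /\
    E Q (fun w => X w ^+ 2) <=
    E Q (fun w => h w ^+ 2) + (B / s%:R) ^+ 2 * E Q (fun=> 1).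
  rewrite !(mean_partition F A); split.
    by apply: eq_bigr => i _; have [] := cell i.
  by rewrite big_distrr -big_split; apply: ler_sum => i _; have [] := cell i.
move=> Q; have [[w1 [Aw1 Fw1]]|Q0] := pselect (exists w, Q w); last first.
  have Q_0 Y : E Q Y = 0.
    rewrite (_ : E Q Y = E Q (fun=> 0)); last first.
      by apply: eq_mean => w Qw; case: Q0; exists w.
    by rewrite mean_cst mul0r.
  by rewrite !Q_0 mulr0 addr0.
set u := up_prob s (g w1) a.
set k := Num.sg (g w1 0 a) * `|g w1| / s%:R.
set m := E Q (fun=> 1).
have m0 : 0 <= m by apply: mean_ge0.
have QE w : Q w -> X w = ((U w a)%:R - u) * k + h w1.
  move=> [Aw Fw]; have [|gw hw] := ghF _ _ Aw Aw1; first by rewrite Fw Fw1.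
  by rewrite /X gw hw decodedB.
have hE w : Q w -> h w = h w1.
  by move=> [Aw Fw]; have [|_ ->] := ghF _ _ Aw Aw1; rewrite // Fw Fw1.
have EU : E Q (fun w => (U w a)%:R) = u * m.
  have := Ulaw _ Aw1; rewrite /= Fw1 => <-.
  rewrite -(mean_indic Q (fun w => U w a) (fun=> 1)).
  by apply: eq_mean => w _; rewrite mulr1.
have Eh : E Q h = h w1 * m by rewrite -mean_cst; exact: eq_mean.
have Eh2 : E Q (fun w => h w ^+ 2) = h w1 ^+ 2 * m.
  by rewrite -mean_cst; apply: eq_mean => w /hE ->.
have affine p r : E Q (fun w => p * (U w a)%:R + r) = p * (u * m) + r * m.
  by rewrite meanD meanZ EU mean_cst.
split.
  rewrite (eq_mean (fun w => k * (U w a)%:R + (h w1 - u * k))); last first.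
    by move=> w /QE -> /=; ring.
  by rewrite affine Eh; ring.
rewrite (eq_mean (fun w => (k ^+ 2 * (1 - 2 * u) + 2 * k * h w1) *
    (U w a)%:R + (h w1 - u * k) ^+ 2)); last first.
  by move=> w /QE ->; case: (U w a) => /=; ring.
rewrite affine Eh2 -/m.
(* A bit equals its square, so what h gains is the variance u (1 - u). *)
have -> : (k ^+ 2 * (1 - 2 * u) + 2 * k * h w1) * (u * m) + (h w1 - u * k) ^+ 2 * m
  = h w1 ^+ 2 * m + k ^+ 2 * (u * (1 - u)) * m by ring.
rewrite lerD2l ler_wpM2r //.
have /andP[u0 u1] : 0 <= u <= 1 := up_prob01 s0 (g w1) a.
have k2 : k ^+ 2 <= (B / s%:R) ^+ 2.
  rewrite -[k ^+ 2]real_normK ?num_real // ler_sqr ?nnegrE ?divr_ge0 //.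
    rewrite !normrM normfV !normr_nat normr_id ler_wpM2r //.
    rewrite (le_trans _ (gB _ Aw1)) // ler_piMl // normr_sg lern1 leq_b1 //.
  exact: le_trans (gB _ Aw1).
by rewrite (le_trans _ k2) // ler_piMr ?sqr_ge0 //; nra.
Qed.

(** In the expansion of the square only the diagonal survives: the errors are
    independent and centred, so a product of two distinct ones has mean zero. *)
Lemma mean_indep_average (M : nat) (I : finType) (W : 'I_M -> Omega -> I)
    (A : set Omega) (X : 'I_M -> Omega -> R) (law phi : 'I_M -> I -> R) (h : R) :
  (forall m i, E (A `&` W m @^-1` [set i]) (fun=> 1) =
    law m i * E A (fun=> 1)) ->
  (forall b : {ffun 'I_M -> I},
    E (A `&` [set w | forall m, W m w = b m]) (fun=> 1) =
    \prod_m law m (b m) * E A (fun=> 1)) ->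
  (forall m w, A w -> X m w = phi m (W m w)) ->
  (forall m, E A (X m) = 0) ->
  E A (fun w => (h + M%:R^-1 * \sum_m X m w) ^+ 2) =
    h ^+ 2 * E A (fun=> 1) +
    (M%:R ^+ 2)^-1 * \sum_m E A (fun w => X m w ^+ 2).
Proof.
move=> marg joint XW X0.
have [A0|A0] := eqVneq (E A (fun=> 1)) 0.
  rewrite mean_null // A0 mulr0 add0r big1 ?mulr0 // => m _.
  by rewrite mean_null.
have law0 m : \sum_i law m i * phi m i = 0.
  apply: (mulIf A0); rewrite mul0r -[RHS](X0 m) [RHS](mean_partition (W m)).
  rewrite big_distrl; apply: eq_bigr => i _ /=.
  rewrite [RHS](eq_mean (fun=> phi m i)); last first.
    by move=> w [Aw <-]; rewrite XW.
  by rewrite [RHS]mean_cst marg mulrCA mulrA.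
have cross m m' : m != m' -> E A (fun w => X m w * X m' w) = 0.
  move=> mm'; rewrite (mean_partition (fun w => [ffun k => W k w])).
  pose psi k i := if k == m then phi k i else if k == m' then phi k i else 1.
  (* Independence splits the mean into one factor per worker; the factor of
     worker m vanishes by law0. *)
  transitivity ((\sum_(b : {ffun 'I_M -> I})
      \prod_k (law k (b k) * psi k (b k))) * E A (fun=> 1)); last first.
    rewrite -(bigA_distr_bigA (fun k i => law k i * psi k i)) /=.
    by rewrite (bigD1 m) //= /psi eqxx law0 !mul0r.
  rewrite big_distrl; apply: eq_bigr => b _ /=.
  rewrite (_ : _ `&` _ = A `&` [set w | forall k, W k w = b k]); last first.
    apply/seteqP; split=> w [Aw /= Wb]; split=> //.
      by move=> k; rewrite -Wb ffunE.
    by apply/ffunP => k; rewrite ffunE.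
  rewrite (eq_mean (fun=> phi m (b m) * phi m' (b m'))); last first.
    by move=> w [Aw Wb]; rewrite !XW // !Wb.
  rewrite mean_cst joint mulrA; congr (_ * _).
  rewrite big_split /= mulrC; congr (_ * _).
  rewrite (bigD1 m) //= (bigD1 m') 1?eq_sym //= big1 => [|k].
    by rewrite /psi eqxx eqxx eq_sym (negPf mm') mulr1.
  by rewrite /psi => /andP[/negPf -> /negPf ->].
rewrite (eq_mean (fun w => h ^+ 2 + (2 * h * M%:R^-1 * \sum_m X m w +
   (M%:R ^+ 2)^-1 * \sum_m \sum_m' X m w * X m' w))); last first.
  move=> w _; have -> : \sum_m \sum_m' X m w * X m' w = (\sum_m X m w) ^+ 2.
    by rewrite expr2 big_distrl; apply: eq_bigr => m _; rewrite big_distrr.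
  by rewrite -exprVn; ring.
rewrite !meanD mean_cst !meanZ !mean_sum big1 ?mulr0 ?add0r //.
congr (_ + _ * _); apply: eq_bigr => m _.
rewrite mean_sum (bigD1 m) //= big1 ?addr0 // => m' m'm.
by rewrite cross // eq_sym.
Qed.

End Conditioning.

(** * Sampling without replacement *)

Section Sampling.
Variables (R : realType) (n s : nat).
Hypotheses (s_gt0 : (0 < s)%N) (s_le_n : (s <= n)%N).
Implicit Types (j k : 'I_n) (a : 'I_n -> R) (A : {set 'I_n}).

Let draws j k : R := \sum_(A : {set 'I_n} | #|A| == s) ((j \in A) && (k \in A))%:R.

Lemma draws_perm (p : {perm 'I_n}) j k : draws (p j) (p k) = draws j k.
Proof.
rewrite /draws (reindex_inj (imset_inj (@perm_inj _ p))) /=.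
apply: eq_big => A; first by rewrite card_imset //; exact: perm_inj.
by move=> _; rewrite !mem_imset //; exact: perm_inj.
Qed.

Lemma drawsC j k : draws j k = draws k j.
Proof. by apply: eq_bigr => A _; rewrite andbC. Qed.

Lemma draws_diag j k : draws j j = draws k k.
Proof. by rewrite -(draws_perm (tperm j k)) tpermL. Qed.

(** The number of s-sets containing two distinct points is the same for all
    pairs, because transpositions act transitively on ordered pairs of distinct
    points. *)
Lemma draws_offdiag j k j' k' : j != k -> j' != k' -> draws j k = draws j' k'.
Proof.
have move1 (a b c : 'I_n) : b != a -> c != a -> draws b a = draws c a.
  by move=> ba ca; rewrite -(draws_perm (tperm b c)) tpermL tpermD // eq_sym.
move=> jk j'k'; have [kj'|kj'] := eqVneq k j'.
  rewrite -kj' in j'k' *.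
  by rewrite (move1 _ _ k') // 1?drawsC // eq_sym.
rewrite (move1 _ _ j') //; last by rewrite eq_sym.
by rewrite drawsC (move1 _ _ k') 1?drawsC // eq_sym.
Qed.

Let n_gt0 : (0 < n)%N. Proof. exact: leq_trans s_gt0 s_le_n. Qed.
Let s0 : s%:R != 0 :> R. Proof. by rewrite pnatr_eq0 -lt0n. Qed.
Let n0 : n%:R != 0 :> R. Proof. by rewrite pnatr_eq0 -lt0n. Qed.
Let N := 'C(n, s)%:R : R.

(** Double counting of the pairs of an s-set and one of its elements. *)
Lemma draws_total j : n%:R * draws j j = s%:R * N.
Proof.
transitivity (\sum_k draws k k).
  rewrite (eq_bigr (fun=> draws j j)) => [|k _]; last exact: draws_diag.
  by rewrite sumr_const card_ord mulr_natl.
rewrite exchange_big /= (eq_bigr (fun=> s%:R)) => [|A /eqP <-].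
  by rewrite sumr_const -cardsE card_draws card_ord mulr_natr.
under eq_bigr do rewrite andbb.
rewrite -sum1_card [in RHS]big_mkcond natr_sum.
by apply: eq_bigr => k _; case: (k \in A).
Qed.

Lemma sum_draws_linear a j :
  \sum_(A : {set 'I_n} | #|A| == s) \sum_(k in A) a k = draws j j * \sum_k a k.
Proof.
under eq_bigr do rewrite big_mkcond.
rewrite exchange_big big_distrr /=; apply: eq_bigr => k _.
rewrite (draws_diag j k) big_distrl /=; apply: eq_bigr => A _.
by rewrite andbb; case: (k \in A); rewrite ?mul1r ?mul0r.
Qed.

Lemma sampling_mean a :
  \sum_(A : {set 'I_n} | #|A| == s) s%:R^-1 * \sum_(k in A) a k =
  N * (n%:R^-1 * \sum_k a k).
Proof.
pose j := Ordinal n_gt0.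
rewrite -big_distrr /= (sum_draws_linear a j).
apply: (mulfI s0); apply: (mulfI n0).
have := draws_total j; set D := draws j j => ND.
transitivity ((n%:R * D) * \sum_k a k); first by field.
by rewrite ND; field.
Qed.

(** As the weights draws are constant off the diagonal, the cross terms
    sum to minus that constant times the sum of squares, the total being zero. *)
Lemma sum_draws_square a j : \sum_k a k = 0 ->
  \sum_(A : {set 'I_n} | #|A| == s) (\sum_(k in A) a k) ^+ 2 <=
  draws j j * \sum_k a k ^+ 2.
Proof.
move=> a0.
have -> : \sum_(A : {set 'I_n} | #|A| == s) (\sum_(k in A) a k) ^+ 2 =
    \sum_k \sum_l draws k l * (a k * a l).
  transitivity (\sum_(A : {set 'I_n} | #|A| == s) \sum_k \sum_l
      ((k \in A) && (l \in A))%:R * (a k * a l)).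
    apply: eq_bigr => A _; rewrite [X in X ^+ 2]big_mkcond expr2 big_distrl /=.
    apply: eq_bigr => k _; rewrite big_distrr; apply: eq_bigr => l _ /=.
    by case: (k \in A); case: (l \in A); rewrite /= ?(mul0r, mulr0, mul1r).
  rewrite exchange_big; apply: eq_bigr => k _ /=.
  by rewrite exchange_big; apply: eq_bigr => l _; rewrite -big_distrl.
have draws_ge0 k l : 0 <= draws k l by apply: sumr_ge0.
have row k : exists2 D, 0 <= D & forall l, l != k -> draws k l = D.
  have [l lk|k1] := pickP (fun l => l != k).
    by exists (draws k l) => // l' l'k; apply: draws_offdiag; rewrite eq_sym.
  by exists 0 => // l lk; have := k1 l; rewrite lk.
have [D D0 DE] : exists2 D, 0 <= D & forall k l, l != k -> draws k l = D.
  have [D D0 DE] := row j; exists D => // k l lk.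
  have [l' l'j|j1] := pickP (fun l => l != j).
    by rewrite -(DE _ l'j); apply: draws_offdiag; rewrite eq_sym.
  have := j1 l; have := j1 k; move/negbFE/eqP => kj /negbFE/eqP lj.
  by rewrite kj lj eqxx in lk.
have -> : \sum_k \sum_l draws k l * (a k * a l) =
    (draws j j - D) * \sum_k a k ^+ 2 + D * (\sum_k a k) ^+ 2.
  rewrite [(\sum_k a k) ^+ 2]expr2 big_distrl !big_distrr -big_split.
  apply: eq_bigr => k _ /=; rewrite big_distrr /= big_distrr /=.
  rewrite (bigD1 k) //= [in RHS](bigD1 k) //= (draws_diag k j) addrA.
  congr (_ + _); first by ring.
  by apply: eq_bigr => l lk; rewrite DE.
rewrite a0 expr0n mulr0 addr0 ler_wpM2r ?sumr_ge0 // => [k _|].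
  exact: sqr_ge0.
by rewrite gerBl.
Qed.

(** Centring the values makes sum_draws_square applicable, and can only
    decrease their sum of squares. *)
Lemma sampling_variance a :
  \sum_(A : {set 'I_n} | #|A| == s)
    (s%:R^-1 * \sum_(k in A) a k - n%:R^-1 * \sum_k a k) ^+ 2 <=
  N * ((s * n)%:R^-1 * \sum_k a k ^+ 2).
Proof.
pose j := Ordinal n_gt0.
set mu := n%:R^-1 * \sum_k a k.
pose a' k := a k - mu.
have a'0 : \sum_k a' k = 0.
  by rewrite sumrB sumr_const card_ord -mulr_natl /mu mulrA divff // mul1r subrr.
have a'2 : \sum_k a' k ^+ 2 <= \sum_k a k ^+ 2.
  have -> : \sum_k a' k ^+ 2 = \sum_k a k ^+ 2 - n%:R * mu ^+ 2.
    transitivity (\sum_k (a k ^+ 2 - mu * (a k + a' k))).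
      by apply: eq_bigr => k _; rewrite /a'; ring.
    rewrite sumrB -big_distrr big_split /= a'0 addr0 /mu.
    by congr (_ - _); field.
  by rewrite gerBl mulr_ge0 ?sqr_ge0.
rewrite (eq_bigr (fun A : {set 'I_n} => s%:R^-2 * (\sum_(k in A) a' k) ^+ 2)).
  rewrite -big_distrr /=.
  apply: le_trans (_ : s%:R^-2 * (draws j j * \sum_k a k ^+ 2) <= _).
    rewrite ler_wpM2l ?invr_ge0 ?sqr_ge0 //.
    apply: le_trans (sum_draws_square j a'0) _.
    by rewrite ler_wpM2l //; apply: sumr_ge0.
  have := draws_total j; set D := draws j j => ND.
  have -> : D = s%:R * N / n%:R by rewrite -ND; field.
  by rewrite natrM le_eqVlt; apply/orP; left; apply/eqP; field; apply/andP.
move=> A /eqP As; rewrite sumrB sumr_const As -mulr_natl.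
by field.
Qed.

End Sampling.

(** * Euclidean geometry and smooth functions *)

Section Euclidean.
Variables (R : realType) (d : nat).
Implicit Types (u v w x y : 'rV[R]_d) (K : set 'rV[R]_d) (h : 'rV[R]_d -> R).

Lemma dotpDl u v w : dotp (u + v) w = dotp u w + dotp v w.
Proof. by rewrite -big_split; apply: eq_bigr => i _; rewrite mxE mulrDl. Qed.

Lemma dotpZl k u v : dotp (k *: u) v = k * dotp u v.
Proof. by rewrite big_distrr /=; apply: eq_bigr => i _; rewrite mxE mulrA. Qed.

Lemma dotpC u v : dotp u v = dotp v u.
Proof. by apply: eq_bigr => i _; rewrite mulrC. Qed.

Lemma dotpNl u v : dotp (- u) v = - dotp u v.
Proof. by rewrite -scaleN1r dotpZl mulN1r. Qed.

Lemma dotpBl u v w : dotp (u - v) w = dotp u w - dotp v w.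
Proof. by rewrite dotpDl dotpNl. Qed.

Lemma dotpDr u v w : dotp w (u + v) = dotp w u + dotp w v.
Proof. by rewrite !(dotpC w) dotpDl. Qed.

Lemma dotpNr u v : dotp u (- v) = - dotp u v.
Proof. by rewrite !(dotpC u) dotpNl. Qed.

Lemma dotp_sqr u : dotp u u = \sum_i u 0 i ^+ 2.
Proof. by apply: eq_bigr => i _; rewrite expr2. Qed.

Lemma dotp_ge0 u : 0 <= dotp u u.
Proof. by rewrite dotp_sqr sumr_ge0 // => i _; exact: sqr_ge0. Qed.

Lemma enorm_ge0 u : 0 <= enorm u. Proof. exact: sqrtr_ge0. Qed.

Lemma enorm_sqr u : enorm u ^+ 2 = \sum_i u 0 i ^+ 2.
Proof. by rewrite sqr_sqrtr ?dotp_ge0 // dotp_sqr. Qed.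

Lemma enormZ k u : enorm (k *: u) = `|k| * enorm u.
Proof.
by rewrite /enorm dotpZl dotpC dotpZl mulrA -expr2 sqrtrM ?sqr_ge0 // sqrtr_sqr.
Qed.

(** From the nonnegativity of the square of |v| u - |u| v. *)
Lemma cauchy_schwarz u v : dotp u v <= enorm u * enorm v.
Proof.
have uu := sqr_sqrtr (dotp_ge0 u); have vv := sqr_sqrtr (dotp_ge0 v).
rewrite -!/(enorm _) in uu vv.
have := enorm_ge0 u; have := enorm_ge0 v.
set a := enorm u in uu *; set b := enorm v in vv * => b0 a0.
have sq : 0 <= 2 * (a * b) * (a * b - dotp u v).
  apply: le_trans (dotp_ge0 (b *: u - a *: v)) _.
  rewrite dotpBl !dotpDr !dotpNr !dotpZl !(dotpC _ (_ *: _)) !dotpZl -uu -vv.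
  by rewrite (dotpC v u) le_eqVlt; apply/orP; left; apply/eqP; ring.
have zero w z : enorm w = 0 -> dotp w z = 0.
  move=> w0; have := enorm_sqr w; rewrite w0 expr0n /= => /esym/eqP.
  rewrite psumr_eq0 => [/allP w_0|i _]; last exact: sqr_ge0.
  apply: big1 => i _; have := w_0 i (mem_index_enum i).
  by rewrite sqrf_eq0 => /eqP ->; rewrite mul0r.
have [/eqP|ab0] := eqVneq (a * b) 0.
  rewrite mulf_eq0 => /orP[/eqP a_0|/eqP b_0].
    by rewrite (zero u v a_0) a_0 mul0r.
  by rewrite dotpC (zero v u b_0) b_0 mulr0.
have ab : 0 < a * b by rewrite lt_def ab0 mulr_ge0.
by rewrite -subr_ge0 -(@pmulr_rge0 _ (2 * (a * b))) // mulr_gt0.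
Qed.

Lemma coord_le_enorm u i : `|u 0 i| <= enorm u.
Proof.
rewrite -sqrtr_sqr ler_wsqrtr // dotp_sqr (bigD1 i) //= lerDl.
by apply: sumr_ge0 => j _; exact: sqr_ge0.
Qed.

Lemma norm_le_enorm u : `|u| <= enorm u.
Proof. by apply: norm_le_coord => [|i]; [exact: enorm_ge0|exact: coord_le_enorm]. Qed.

Lemma enorm_le_norm u : enorm u <= Num.sqrt d%:R * `|u|.
Proof.
have -> : Num.sqrt d%:R * `|u| = Num.sqrt (d%:R * `|u| ^+ 2).
  by rewrite sqrtrM // sqrtr_sqr normr_id.
have -> : d%:R * `|u| ^+ 2 = \sum_(i < d) `|u| ^+ 2.
  by rewrite sumr_const card_ord mulr_natl.
rewrite ler_wsqrtr // dotp_sqr.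
apply: ler_sum => i _; rewrite -[leLHS]real_normK ?num_real //.
by rewrite ler_sqr ?nnegrE // coord_le_norm.
Qed.

Lemma convex_step K x v (t : R) : convex_set K -> K x -> K v ->
  0 <= t <= 1 -> K (x + t *: (v - x)).
Proof.
move=> cK Kx Kv t01.
pose t' : {i01 R} := Itv01 (andP t01).1 (andP t01).2.
have /set_mem := cK v x t' (mem_set Kv) (mem_set Kx).
suff -> : conv t' (v : convex_lmodType _) x = x + t *: (v - x) by [].
rewrite [LHS](_ : _ = t *: v + (1 - t) *: x) //.
by rewrite scalerBl scale1r scalerBr addrCA.
Qed.

Lemma le_diameter K x y : compact K -> K x -> K y -> enorm (x - y) <= diameter K.
Proof.
move=> cK Kx Ky; apply: ub_le_sup; last by exists (x, y).
have [B [Br KB]] := compact_bounded cK.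
have KB1 z : K z -> `|z| <= B + 1 by move=> Kz; apply: KB => //; rewrite ltrDl.
exists (Num.sqrt d%:R * ((B + 1) + (B + 1))) => _ [[a b] [/= Ka Kb] <-].
apply: le_trans (enorm_le_norm _) _; rewrite ler_wpM2l ?sqrtr_ge0 //.
by rewrite (le_trans (ler_normB _ _)) // lerD ?KB1.
Qed.

Lemma diameter_ge0 K x : compact K -> K x -> 0 <= diameter K.
Proof. by move=> cK Kx; apply: le_trans (le_diameter cK Kx Kx); exact: enorm_ge0. Qed.

(** L may be negative, but only if K is a single point; then both sides are 0. *)
Lemma smooth_le_diameter K L h x y : compact K -> smooth_on K L h -> K x -> K y ->
  L * enorm (x - y) ^+ 2 <= L * diameter K ^+ 2.
Proof.
move=> cK [_ hL] Kx Ky; have xyD := le_diameter cK Kx Ky.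
have [L0|L0] := leP 0 L.
  rewrite ler_wpM2l // ler_sqr ?nnegrE ?enorm_ge0 //.
  exact: diameter_ge0 cK Kx.
have deg z z' : K z -> K z' -> enorm (z - z') = 0.
  move=> Kz Kz'; have := le_trans (enorm_ge0 _) (hL _ _ Kz Kz').
  by rewrite nmulr_rge0 // => zz; apply/le_anti; rewrite zz enorm_ge0.
rewrite deg // expr0n mulr0 (_ : diameter K = 0) ?expr0n ?mulr0 //.
apply/le_anti; rewrite (diameter_ge0 cK Kx) andbT.
apply: ge_sup; first by exists (enorm (x - x)), (x, x).
by move=> _ [[a b] [/= Ka Kb] <-]; rewrite deg.
Qed.

Lemma derive_grad h x v : differentiable h x -> 'D_v h x = dotp (grad h x) v.
Proof.
move=> hx; rewrite deriveE // {1}(row_sum_delta v) linear_sum.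
by apply: eq_bigr => i _; rewrite linearZ mxE deriveE // mulrC.
Qed.

(** The difference quotients of s -> h (x + s v) at t are those of h at
    x + t v in the direction v. *)
Lemma is_derive_line h x v (t : R) : differentiable h (x + t *: v) ->
  is_derive t 1 (fun s : R => h (x + s *: v)) (dotp (grad h (x + t *: v)) v).
Proof.
move=> hd; rewrite -derive_grad //.
have lineE : (fun k : R => k^-1 *: (((fun s : R => h (x + s *: v)) \o shift t) (k *: 1)
     - h (x + t *: v))) =
    (fun k : R => k^-1 *: ((h \o shift (x + t *: v)) (k *: v) - h (x + t *: v))).
  apply/funext => k /=; congr (_ *: (h _ - _)).
  by rewrite [k *: 1]mulr1 scalerDl addrCA.
split; first by rewrite /derivable lineE; exact: diff_derivable.
by rewrite /derive lineE.
Qed.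

(** The mean value theorem applied on [0, 1] to h (x + t v) - L t^2 |v|^2 / 2,
    whose derivative is at most its value at 0 by smoothness. *)
Lemma descent K L h x y : convex_set K -> smooth_on K L h -> K x -> K y ->
  h y <= h x + dotp (grad h x) (y - x) + L / 2 * enorm (y - x) ^+ 2.
Proof.
move=> cK [hd hL] Kx Ky; set v := y - x.
have Kseg (t : R) : 0 <= t <= 1 -> K (x + t *: v) by exact: convex_step.
pose phi (t : R) := h (x + t *: v) - L / 2 * enorm v ^+ 2 * t ^+ 2.
pose dphi (t : R) := dotp (grad h (x + t *: v)) v - L * enorm v ^+ 2 * t.
have phi_d (t : R) : t \in `[0, 1] -> is_derive t 1 phi (dphi t).
  rewrite in_itv /= => t01; have hl := is_derive_line (hd _ (Kseg _ t01)).
  have sq := is_deriveZ (L / 2 * enorm v ^+ 2) (is_deriveX 2 (is_derive_id t 1)).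
  have -> : phi = (fun s : R => h (x + s *: v)) - (L / 2 * enorm v ^+ 2) \*: id ^+ 2.
    by apply/funext => s.
  apply: is_derive_eq (is_deriveB hl sq) _.
  rewrite /dphi; congr (_ - _); rewrite /GRing.scale /= mulr1 expr1.
  by clear; move: (enorm v ^+ 2) => e; field.
have phi_oo (t : R) : t \in `]0, 1[ -> is_derive t 1 phi (dphi t).
  by move=> t01; apply: phi_d; exact: subset_itv_oo_cc t01.
have phi_c : {within `[0, 1], continuous phi}.
  by apply: derivable_within_continuous => t /phi_d [].
have [t] := @MVT R phi dphi 0 1 ltr01 phi_oo phi_c.
rewrite in_itv /= => /andP[t0 t1].
rewrite /phi /dphi scale0r scale1r addr0 subr0 mulr1 expr0n expr1n mulr0 subr0 mulr1.
rewrite (_ : x + v = y) => [hE|]; last by rewrite /v addrC subrK.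
suff : dotp (grad h (x + t *: v)) v - L * enorm v ^+ 2 * t <= dotp (grad h x) v.
  by lra.
rewrite lerBlDr -lerBlDl -dotpBl (le_trans (cauchy_schwarz _ _)) //.
have := hL _ _ (Kseg t _) Kx; rewrite (ltW t0) (ltW t1) => /(_ isT).
rewrite addrAC subrr add0r enormZ gtr0_norm // => gL.
rewrite (le_trans (ler_wpM2r (enorm_ge0 v) gL)) // le_eqVlt.
by apply/orP; left; apply/eqP; ring.
Qed.

Lemma is_derive_lincomb (I : eqType) (s : seq I) (c : I -> R) (h : I -> 'rV[R]_d -> R) x v :
  (forall i, differentiable (h i) x) ->
  is_derive x v (fun y => \sum_(i <- s) c i * h i y) (\sum_(i <- s) c i * 'D_v (h i) x).
Proof.
move=> hd; elim: s => [|i s IHs].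
  by under eq_fun do rewrite big_nil; rewrite big_nil; exact: is_derive_cst.
under eq_fun do rewrite big_cons; rewrite big_cons.
apply: is_deriveD.
by apply: is_deriveZ; apply/derivableP/diff_derivable.
Qed.

Lemma grad_lincomb (I : finType) (c : I -> R) (h : I -> 'rV[R]_d -> R) x :
  (forall i, differentiable (h i) x) ->
  grad (fun y => \sum_i c i * h i y) x = \sum_i c i *: grad (h i) x.
Proof.
move=> hd; apply/rowP => k; rewrite mxE summxE.
have [_ ->] := is_derive_lincomb (index_enum I) c (delta_mx 0 k) hd.
by apply: eq_bigr => i _; rewrite !mxE.
Qed.

Lemma grad_average n (A : {set 'I_n}) (h : 'I_n -> 'rV[R]_d -> R) x :
  (forall j, differentiable (h j) x) ->
  grad (average A h) x = #|A|%:R^-1 *: \sum_(j in A) grad (h j) x.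
Proof.
move=> hd; have -> : average A h =
    fun y => \sum_j (if j \in A then #|A|%:R^-1 else 0) * h j y.
  apply/funext => y; rewrite /average big_distrr big_mkcond; apply: eq_bigr => j _.
  by case: ifP; rewrite ?mul0r.
rewrite grad_lincomb // scaler_sumr [RHS]big_mkcond; apply: eq_bigr => j _.
by case: ifP; rewrite ?scale0r.
Qed.

Lemma objectiveE M n (f : 'I_M -> 'I_n -> 'rV[R]_d -> R) :
  objective f =
  fun y => \sum_(p : 'I_M * 'I_n) (M * n)%:R^-1 * f p.1 p.2 y.
Proof.
by apply/funext => y; rewrite -big_distrr -(pair_bigA _ (fun m j => f m j y)).
Qed.

Lemma grad_objective M n (f : 'I_M -> 'I_n -> 'rV[R]_d -> R) x :
  (forall m j, differentiable (f m j) x) ->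
  grad (objective f) x =
  M%:R^-1 *: \sum_m (n%:R^-1 *: \sum_j grad (f m j) x).
Proof.
move=> fd; rewrite objectiveE grad_lincomb => [|p]; last exact: fd.
rewrite -scaler_sumr -(pair_bigA _ (fun m j => grad (f m j) x)) /= -scaler_sumr.
by rewrite scalerA natrM invfM.
Qed.

(** Averaging the quadratic upper models of the components. *)
Lemma objective_descent M n (f : 'I_M -> 'I_n -> 'rV[R]_d -> R) K L x y :
  (0 < M)%N -> (0 < n)%N ->
  convex_set K -> (forall m j, smooth_on K L (f m j)) -> K x -> K y ->
  objective f y <= objective f x + dotp (grad (objective f) x) (y - x) +
    L / 2 * enorm (y - x) ^+ 2.
Proof.
move=> M0 n0 cK fS Kx Ky.
have N0 : (M * n)%:R != 0 :> R by rewrite pnatr_eq0 -lt0n muln_gt0 M0.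
have fd m j : differentiable (f m j) x by have [fd _] := fS m j; exact: fd.
rewrite {1}objectiveE.
apply: le_trans (_ : \sum_(p : 'I_M * 'I_n) (M * n)%:R^-1 * (f p.1 p.2 x +
  dotp (grad (f p.1 p.2) x) (y - x) + L / 2 * enorm (y - x) ^+ 2) <= _).
  apply: ler_sum => p _; rewrite ler_wpM2l ?invr_ge0 //; exact: (descent cK (fS _ _) Kx Ky).
rewrite -big_distrr !big_split /= sumr_const card_prod !card_ord !mulrDr.
rewrite -(mulr_natl (L / 2 * _)) [_^-1 * (_%:R * _)]mulrA mulVf // mul1r objectiveE big_distrr /=.
rewrite grad_lincomb => [|p]; last exact: fd.
rewrite -scaler_sumr dotpZl lerD2r lerD2l ler_wpM2l ?invr_ge0 //.
rewrite le_eqVlt; apply/orP; left; apply/eqP; rewrite /dotp exchange_big.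
by apply: eq_bigr => i _; rewrite summxE big_distrl.
Qed.

End Euclidean.

(** * The run along one outcome *)

Lemma round_index_pos_lt (p : nat -> nat) t : (forall i, 0 < p i)%N ->
  ((round_index p t).2 < p (round_index p t).1)%N.
Proof.
move=> p0; elim: t => [|t] /=; first exact: p0.
by case: (round_index p t) => i k /= _; case: ifP.
Qed.

Lemma round_index_pred (p : nat -> nat) t k : (round_index p t).2 = k.+1 ->
  exists2 u, t = u.+1 & (round_index p u).2 = k.
Proof.
case: t => [//|u] /=; case ul: (round_index p u) => [i l].
by case: ifP => _ //= [<-]; exists u; rewrite ?ul.
Qed.

Section Run.
Variables (R : realType) (d M n T : nat) (Omega : Type).
Variables (K : set 'rV[R]_d) (f : 'I_M -> 'I_n -> 'rV[R]_d -> R) (L : R).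
Variables (prm : qfw_params R) (x1 : 'rV[R]_d).
Variables (c : qfw_choices d M n Omega) (q : qfw_process R d M Omega).
Hypotheses (Kconv : convex_set K) (Kx1 : K x1).
Hypothesis fS : forall m j, smooth_on K L (f m j).
Hypothesis eta01 : forall t, 0 <= step_size prm t <= 1.
Hypothesis run : qfw_run prm K f T x1 c q.

Local Notation x := (iter_pt q).
Local Notation pos t := (round_index (period prm) t).2.
Local Notation s1 t := (level1 prm (round_index (period prm) t).1 (pos t)).
Local Notation s2 t := (level2 prm (round_index (period prm) t).1 (pos t)).

Lemma iter_pt_in t w : (t <= T)%N -> K (x t w).
Proof.
elim: t => [_|t IHt tT]; first by rewrite (qfw_init run).
rewrite (qfw_step run w tT); apply: convex_step => //; first exact: IHt (ltnW tT).
exact: (qfw_lmo_in run).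
Qed.

Lemma f_differentiable t w m j : (t <= T)%N -> differentiable (f m j) (x t w).
Proof. by move=> tT; have [+ _] := fS m j; apply; exact: iter_pt_in. Qed.

Lemma past_le u t w0 w : (u <= t)%N -> past c t w0 w -> past c u w0 w.
Proof. by move=> ut tw v vu; apply: tw; exact: leq_trans vu ut. Qed.

Lemma past_eq t w0 w : past c t w0 w -> past c t w = past c t w0.
Proof.
move=> ww0; apply/seteqP; split=> w' ww' u ut.
  have [a0 b0] := ww0 u ut; have [a b] := ww' u ut; split=> [m|]; last by rewrite b b0.
  by have [-> ->] := a m; have [-> ->] := a0 m.
have [a0 b0] := ww0 u ut; have [a b] := ww' u ut; split=> [m|]; last by rewrite b b0.
by have [-> ->] := a m; have [-> ->] := a0 m.
Qed.

Lemma iter_past t w0 w : (t <= T)%N -> past c t w0 w -> x t w = x t w0.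
Proof.
elim: t => [|t IHt] tT pw; first by rewrite !(qfw_init run).
rewrite !(qfw_step run _ tT) (qfw_lmo_adapted run tT pw).
by rewrite (IHt (ltnW tT) (past_le (leqnSn t) pw)).
Qed.

(** What component (m, j) contributes to the vector encoded in round t: its
    gradient at the head of a period, and the change of its gradient since the
    previous iterate elsewhere. *)
Definition increment t m j w : 'rV[R]_d :=
  if pos t == 0%N then grad (f m j) (x t w)
  else grad (f m j) (x t w) - grad (f m j) (x t.-1 w).

(** The average of the increments over a sample; over all of 'I_n it is the
    vector that worker m tries to estimate. *)
Definition increment_mean t m (S : {set 'I_n}) w : 'rV[R]_d :=
  #|S|%:R^-1 *: \sum_(j in S) increment t m j w.

Definition grad_error t w : 'rV[R]_d := gbar q t w - grad (objective f) (x t w).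

(** The error carried over from the previous round; the head of a period
    starts afresh. *)
Definition inherited_error t w : 'rV[R]_d :=
  if pos t == 0%N then 0 else grad_error t.-1 w.

Lemma increment_past t m j w0 w : (t <= T)%N -> past c t w0 w ->
  increment t m j w = increment t m j w0.
Proof.
move=> tT pw; rewrite /increment (iter_past tT pw).
have t1 : (t.-1 <= t)%N := leq_pred t.
by rewrite (iter_past (leq_trans t1 tT) (past_le t1 pw)).
Qed.

Lemma increment_mean_past t m S w0 w : (t <= T)%N -> past c t w0 w ->
  increment_mean t m S w = increment_mean t m S w0.
Proof.
move=> tT pw; congr (_ *: _).
by apply: eq_bigr => j _; exact: increment_past pw.
Qed.

Lemma gloc_increment t m w : (t < T)%N ->
  gloc q t m w = increment_mean t m (sample c t m w) w.
Proof.
move=> tT; have := qfw_gloc run m w tT.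
have tT' := ltnW tT; have t1T := leq_trans (leq_pred t) tT'.
rewrite /increment_mean /increment; case: (round_index _ t) => i k /= ->.
case: eqP => _; rewrite !grad_average; try by move=> j; exact: f_differentiable.
by [].
by rewrite -scalerBr -sumrB.
Qed.

Lemma gavg_worker t w : (t < T)%N -> gavg q t w =
  M%:R^-1 *: \sum_m decoded (s1 t) (gloc q t m w) (up1 c t m w).
Proof. by move=> tT; have := qfw_gavg run w tT; case: (round_index _ t). Qed.

Lemma gbar_master t w : (t < T)%N -> gbar q t w =
  decoded (s2 t) (gavg q t w) (up2 c t w) +
  (if pos t == 0%N then 0 else gbar q t.-1 w).
Proof.
move=> tT; have := qfw_gbar run w tT; case: (round_index _ t) => i k /= ->.
by case: ifP => // _; rewrite addr0.
Qed.

Lemma gloc_past t m w0 w : (t < T)%N -> past c t w0 w ->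
  sample c t m w = sample c t m w0 -> gloc q t m w = gloc q t m w0.
Proof.
move=> tT pw sw; rewrite !gloc_increment // sw.
exact: increment_mean_past (ltnW tT) pw.
Qed.

Lemma gavg_past t w0 w : (t < T)%N -> past c t w0 w ->
  (forall m, sample c t m w = sample c t m w0 /\ up1 c t m w = up1 c t m w0) ->
  gavg q t w = gavg q t w0.
Proof.
move=> tT pw cw; rewrite !gavg_worker //; congr (_ *: _).
apply: eq_bigr => m _; have [sw ->] := cw m.
by rewrite (gloc_past tT pw sw).
Qed.

Lemma gbar_past t w0 w : (t < T)%N -> past c t.+1 w0 w ->
  gbar q t w = gbar q t w0.
Proof.
elim: t => [|t IHt] tT pw; rewrite (gbar_master w tT) (gbar_master w0 tT).
  have [cw ->] := pw 0%N (ltnSn 0).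
  by rewrite (gavg_past tT (past_le (leqnSn 0) pw) cw).
have [cw ->] := pw t.+1 (ltnSn t.+1).
have pw' := past_le (leqnSn t.+1) pw.
by rewrite (gavg_past tT pw' cw) (IHt (ltnW tT) pw').
Qed.

Lemma inherited_error_past t w0 w : (t < T)%N -> past c t w0 w ->
  inherited_error t w = inherited_error t w0.
Proof.
move=> tT; rewrite /inherited_error.
case pk: (pos t) => [|k] //=; have [u tu _] := round_index_pred pk.
rewrite tu in tT * => pw; rewrite /grad_error /=.
rewrite (gbar_past (ltnW tT) pw).
by rewrite (iter_past (ltnW (ltnW tT)) (past_le (leqnSn u) pw)).
Qed.

(** The gradient is linear on functions differentiable at the iterates, so it
    commutes with the averages over workers and components. *)
Lemma mean_increment t w : (t < T)%N ->
  M%:R^-1 *: \sum_m increment_mean t m [set: 'I_n]%SET w =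
  grad (objective f) (x t w) -
  (if pos t == 0%N then 0 else grad (objective f) (x t.-1 w)).
Proof.
move=> tT; have tT' := ltnW tT; have t1T := leq_trans (leq_pred t) tT'.
rewrite !grad_objective; try by move=> *; exact: f_differentiable.
rewrite /increment_mean /increment cardsT card_ord.
case: eqP => _.
  rewrite subr0; congr (_ *: _); apply: eq_bigr => m _; congr (_ *: _).
  by apply: eq_bigl => j; rewrite inE.
rewrite -scalerBr -sumrB; congr (_ *: _); apply: eq_bigr => m _.
rewrite -scalerBr -sumrB; congr (_ *: _).
by apply: eq_bigl => j; rewrite inE.
Qed.

(** The first line is the rounding error of the master, the last sum gathers
    the errors of the workers. *)
Lemma grad_error_rec t w : (t < T)%N -> grad_error t w =
  decoded (s2 t) (gavg q t w) (up2 c t w) - gavg q t w +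
  (inherited_error t w + M%:R^-1 *: \sum_m
    (decoded (s1 t) (gloc q t m w) (up1 c t m w) -
     increment_mean t m [set: 'I_n]%SET w)).
Proof.
move=> tT; rewrite sumrB scalerBr -gavg_worker // mean_increment //.
rewrite /inherited_error /grad_error (gbar_master w tT).
case: ifP => _; apply/rowP => a; rewrite !mxE; ring.
Qed.

End Run.

(** * The error of one round *)

Section RunLaw.
Variables (R : realType) (d M n T : nat).
Variables (disp : measure_display) (Omega : measurableType disp).
Variables (P : probability Omega R).
Variables (K : set 'rV[R]_d) (f : 'I_M -> 'I_n -> 'rV[R]_d -> R) (L : R).
Variables (prm : qfw_params R) (x1 : 'rV[R]_d).
Variables (c : qfw_choices d M n Omega) (q : qfw_process R d M Omega).
Variables (o : Omega -> 'I_T) (w_ : Omega).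
Hypotheses (M_gt0 : (0 < M)%N).
Hypotheses (Kconv : convex_set K) (Kx1 : K x1).
Hypothesis fS : forall m j, smooth_on K L (f m j).
Hypothesis eta01 : forall t, 0 <= step_size prm t <= 1.
Hypothesis run : qfw_run prm K f T x1 c q.
Hypothesis law : qfw_law P prm T c q.
Hypothesis o_rv : discrete_rv o.

Local Notation x := (iter_pt q).
Local Notation pos t := (round_index (period prm) t).2.
Local Notation s1 t := (level1 prm (round_index (period prm) t).1 (pos t)).
Local Notation s2 t := (level2 prm (round_index (period prm) t).1 (pos t)).
Local Notation imean := (increment_mean f prm q).
Local Notation err := (grad_error f q).
Local Notation inherited := (inherited_error f prm q).

(** The round index is bounded, so the choices made before round t form an
    element of a finite type. *)
Definition history t w : {ffun 'I_t ->
    {ffun 'I_M -> {set 'I_n} * {ffun 'I_d -> bool}} * {ffun 'I_d -> bool}} :=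
  [ffun u : 'I_t => ([ffun m => (sample c u m w, up1 c u m w)], up2 c u w)].

Definition outcome w := (history T w, o w).

Local Notation E := (mean P outcome w_).

Lemma historyP t w0 w : past c t w0 w <-> history t w = history t w0.
Proof.
split=> [pw|hw u ut].
  apply/ffunP => u; rewrite !ffunE; have [cu ->] := pw u (ltn_ord u).
  by congr (_, _); apply/ffunP => m; rewrite !ffunE; have [-> ->] := cu m.
move/ffunP: hw => /(_ (Ordinal ut)); rewrite !ffunE => -[cu ->]; split=> // m.
by move/ffunP: cu => /(_ m); rewrite !ffunE => -[-> ->].
Qed.

Lemma outcome_rv : discrete_rv outcome.
Proof.
apply: discrete_rv_pair o_rv; apply: discrete_rv_ffun => u.
apply: discrete_rv_pair; last exact: (qfw_up2_rv law).
apply: discrete_rv_ffun => m.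
by apply: discrete_rv_pair; [exact: (qfw_sample_rv law)|exact: (qfw_up1_rv law)].
Qed.

Lemma determined_past (A : set Omega) :
  (forall w w', past c T w w' -> A w -> A w') -> determined outcome A.
Proof. by move=> pA w w' [hw _]; apply: pA; apply/historyP. Qed.

Lemma past_determined t w0 : (t <= T)%N -> determined outcome (past c t w0).
Proof.
move=> tT; apply: determined_past => w w' ww' w0w.
rewrite -(past_eq w0w); exact: past_le ww'.
Qed.

Lemma worker_determined t m S b : (t < T)%N ->
  determined outcome [set w | sample c t m w = S /\ up1 c t m w = b].
Proof.
move=> tT; apply: determined_past => w w' /(_ t tT) [cw _] /=.
by have [-> ->] := cw m.
Qed.

Lemma sample_determined t m S : (t < T)%N ->
  determined outcome [set w | sample c t m w = S].
Proof.
move=> tT; apply: determined_past => w w' /(_ t tT) [cw _] /=.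
by have [-> _] := cw m.
Qed.

(** The pasts are the classes of the partition by the history. *)
Lemma mean_pasts t (X Y : Omega -> R) : (t <= T)%N ->
  (forall w0, E (past c t w0) X <= E (past c t w0) Y) ->
  E setT X <= E setT Y.
Proof.
move=> tT XY; rewrite !(mean_partition (history t) setT); apply: ler_sum => h _.
have [[w0 hw0]|h0] := pselect (exists w0, history t w0 = h).
  rewrite (_ : _ `&` _ = past c t w0); first exact: XY.
  rewrite setTI; apply/seteqP; split=> w; first by move=> /= hw; apply/historyP; rewrite hw.
  by move=> /historyP /= ->.
have no w : ~ ([set: Omega] `&` history t @^-1` [set h]) w.
  by move=> [_ hw]; apply: h0; exists w.
by apply: ler_mean => w /no.
Qed.

Section Round.
Variables (t : nat) (w0 : Omega) (B : R) (vs : 'I_M -> 'I_d -> R).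
Hypothesis tT : (t < T)%N.
Hypothesis B0 : 0 <= B.
Hypothesis incB : forall m j w, `|increment f prm q t m j w| <= B.
Hypothesis s1_gt0 : (0 < d)%N -> (0 < s1 t)%N.
Hypothesis s2_gt0 : (0 < d)%N -> (0 < s2 t)%N.

Local Notation A := (past c t w0).
Local Notation target m w := (imean t m [set: 'I_n]%SET w).

Definition sampling_error m a w : R :=
  (imean t m (sample c t m w) w - target m w) 0 a.

Definition worker_error m a w : R :=
  (decoded (s1 t) (gloc q t m w) (up1 c t m w) - target m w) 0 a.

Hypothesis sampling0 : forall m a, E A (sampling_error m a) = 0.
Hypothesis sampling2 : forall m a,
  E A (fun w => sampling_error m a w ^+ 2) <= vs m a * E A (fun=> 1).

Lemma gloc_norm m w : `|gloc q t m w| <= B.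
Proof. by rewrite (gloc_increment Kconv Kx1 fS eta01 run) //; exact: average_norm. Qed.

(** In dimension 0 the levels may be 0, but then all vectors are 0. *)
Lemma gavg_norm w : `|gavg q t w| <= B.
Proof.
have [->|[a]] : (gavg q t w = 0) \/ exists a : 'I_d, True.
  have [d0|/card_gt0P[a _]] := posnP #|'I_d|; last by right; exists a.
  by left; apply/rowP => a; have := card0_eq d0 a.
  by rewrite normr0.
move=> _; have dgt0 : (0 < d)%N := leq_ltn_trans (leq0n a) (ltn_ord a).
rewrite (gavg_worker run) // -[M in M%:R^-1]card_ord.
apply: average_norm => // m.
by apply: le_trans (gloc_norm m w); exact: decoded_norm (s1_gt0 dgt0) _ _.
Qed.

Lemma past_trans w w' : A w -> A w' -> past c t w w'.
Proof. by move=> Aw Aw'; rewrite (past_eq Aw). Qed.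

(** The rounding of worker m, given its sample, is added to its sampling
    error. *)
Lemma worker_error_mean m a : E A (worker_error m a) = 0 /\
  E A (fun w => worker_error m a w ^+ 2) <=
  (vs m a + (B / (s1 t)%:R) ^+ 2) * E A (fun=> 1).
Proof.
have dgt0 : (0 < d)%N := leq_ltn_trans (leq0n a) (ltn_ord a).
have [|||] := @mean_quantize _ _ _ P _ outcome w_ _ (sample c t m) A d (s1 t)
    (gloc q t m) (up1 c t m) a (sampling_error m a) B (s1_gt0 dgt0).
- move=> w w' Aw Aw' sw; have ww' := past_trans Aw' Aw.
  split; first exact: (gloc_past Kconv Kx1 fS eta01 run tT ww' sw).
  rewrite /sampling_error sw.
  rewrite (increment_mean_past run m (sample c t m w') (ltnW tT) ww').
  by rewrite (increment_mean_past run m [set: 'I_n]%SET (ltnW tT) ww').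
- move=> w Aw Q.
  have dQ : determined outcome Q.
    rewrite /Q; apply: determinedI; first exact: past_determined (ltnW tT).
    exact: sample_determined.
  have dU : determined outcome [set w' | up1 c t m w' a].
    by apply: determined_past => v v' /(_ t tT) [cv _] /=; have [_ ->] := cv m.
  rewrite (mean_cond P w_ outcome_rv dQ dU).
  have [PQ|PQ] := eqVneq (P Q) 0%E.
    by rewrite (mean_one P w_ outcome_rv dQ) PQ !mulr0.
  congr (_ * _); have := @qfw_up1_law _ _ _ _ _ _ _ _ _ _ _ law t m w a tT.
  rewrite (past_eq Aw); case: (round_index _ t) => i k /=; exact.
- by move=> w _; exact: gloc_norm.
have XE w : A w -> worker_error m a w =
    decoded (s1 t) (gloc q t m w) (up1 c t m w) 0 a - gloc q t m w 0 a +
    sampling_error m a w.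
  move=> _; rewrite /sampling_error /worker_error.
  by rewrite (gloc_increment Kconv Kx1 fS eta01 run) // !coordB addrA subrK.
move=> X0 X2; split; first by rewrite (eq_mean _ XE) X0 sampling0.
apply: le_trans (_ : E A (fun w => sampling_error m a w ^+ 2) +
  (B / (s1 t)%:R) ^+ 2 * E A (fun=> 1) <= _).
  by apply: le_trans X2; apply: ler_mean => w Aw; rewrite XE.
by rewrite mulrDl lerD2r.
Qed.

(** The rounding of the master, given all the choices of the workers, is added
    to the inherited error plus the average of the worker errors.  Given the
    past the inherited error is a constant, and the worker errors are
    independent and centred. *)
Lemma coord_error_mean a : E A (fun w => err t w 0 a ^+ 2) <=
  E A (fun w => inherited t w 0 a ^+ 2) +
  ((M%:R ^+ 2)^-1 * \sum_m (vs m a + (B / (s1 t)%:R) ^+ 2) +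
   (B / (s2 t)%:R) ^+ 2) * E A (fun=> 1).
Proof.
have dgt0 : (0 < d)%N := leq_ltn_trans (leq0n a) (ltn_ord a).
pose W m w := (sample c t m w, up1 c t m w).
pose h w := inherited t w 0 a + M%:R^-1 * \sum_m worker_error m a w.
have [|||] := @mean_quantize _ _ _ P _ outcome w_ _
    (fun w => [ffun m => W m w]) A d (s2 t)
    (gavg q t) (up2 c t) a h B (s2_gt0 dgt0).
- move=> w w' Aw Aw' /ffunP Ww; have ww' := past_trans Aw' Aw.
  have cw m : sample c t m w = sample c t m w' /\ up1 c t m w = up1 c t m w'.
    by have := Ww m; rewrite !ffunE => -[].
  have hs : \sum_m worker_error m a w = \sum_m worker_error m a w'.
    apply: eq_bigr => m _; have [sw uw] := cw m.
    rewrite /worker_error uw (gloc_past Kconv Kx1 fS eta01 run tT ww' sw).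
    by rewrite (increment_mean_past run m [set: 'I_n]%SET (ltnW tT) ww').
  split; first exact: (gavg_past Kconv Kx1 fS eta01 run tT ww' cw).
  have hi := inherited_error_past Kconv Kx1 fS eta01 run tT ww'.
  exact: (f_equal2 (fun (v : 'rV_d) S => v 0 a + M%:R^-1 * S) hi hs).
- move=> w Aw Q.
  have QE : Q = past c t w `&` [set w' | forall m,
      sample c t m w' = sample c t m w /\ up1 c t m w' = up1 c t m w].
    rewrite /Q (past_eq Aw); congr (_ `&` _); apply/seteqP; split=> w' /=.
      by move=> /ffunP Ww m; have := Ww m; rewrite !ffunE => -[].
    by move=> Ww; apply/ffunP => m; rewrite !ffunE /W; have [-> ->] := Ww m.
  have dQ : determined outcome Q.
    rewrite QE; apply: determinedI; first exact: past_determined (ltnW tT).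
    apply: determined_past => v v' /(_ t tT) [cv _] /= cw m.
    by have [-> ->] := cv m.
  have dU : determined outcome [set w' | up2 c t w' a].
    by apply: determined_past => v v' /(_ t tT) [_ /= ->].
  rewrite (mean_cond P w_ outcome_rv dQ dU).
  have [PQ|PQ] := eqVneq (P Q) 0%E.
    by rewrite (mean_one P w_ outcome_rv dQ) PQ !mulr0.
  congr (_ * _); have := @qfw_up2_law _ _ _ _ _ _ _ _ _ _ _ law t w a tT.
  by rewrite -QE; case: (round_index _ t) => i k /=; exact.
- by move=> w _; exact: gavg_norm.
have XE w : err t w 0 a =
    decoded (s2 t) (gavg q t w) (up2 c t w) 0 a - gavg q t w 0 a + h w.
  rewrite (grad_error_rec Kconv Kx1 fS eta01 run w tT) mxE coordB; congr (_ + _).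
  by rewrite /h mxE [in LHS]mxE summxE.
move=> _ X2; apply: le_trans (_ : _ <= E A (fun w => h w ^+ 2) +
    (B / (s2 t)%:R) ^+ 2 * E A (fun=> 1)) _.
  by apply: le_trans X2; apply: ler_mean => w _; rewrite XE.
rewrite mulrDl addrA lerD2r.
have -> : E A (fun w => h w ^+ 2) = E A (fun w =>
    (inherited t w0 0 a + M%:R^-1 * \sum_m worker_error m a w) ^+ 2).
  by apply: eq_mean => w Aw; rewrite /h (inherited_error_past Kconv Kx1 fS eta01 run tT Aw).
have -> : E A (fun w => inherited t w 0 a ^+ 2) =
    inherited t w0 0 a ^+ 2 * E A (fun=> 1).
  rewrite -mean_cst; apply: eq_mean => w Aw.
  by rewrite (inherited_error_past Kconv Kx1 fS eta01 run tT Aw).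
pose phi m (i : {set 'I_n} * {ffun 'I_d -> bool}) : R :=
  (decoded (s1 t) (imean t m i.1 w0) i.2 - target m w0) 0 a.
pose lw m (i : {set 'I_n} * {ffun 'I_d -> bool}) : R :=
  cond_pr P A [set w | sample c t m w = i.1 /\ up1 c t m w = i.2].
have dA : determined outcome A by exact: past_determined (ltnW tT).
rewrite (@mean_indep_average _ _ _ P _ outcome w_ M _ W A _ lw phi).
- rewrite lerD2l -mulrA ler_wpM2l ?invr_ge0 ?sqr_ge0 // big_distrl.
  by apply: ler_sum => m _; have [] := worker_error_mean m a.
- move=> m [S b]; rewrite -(mean_cond P w_ outcome_rv dA (worker_determined tT)).
  by congr (E (_ `&` _) _); rewrite /W; apply/seteqP; split=> w /= [-> ->].
- move=> b; pose dW := [set w | forall m, sample c t m w = (b m).1 /\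
    up1 c t m w = (b m).2].
  have -> : [set w | forall m, W m w = b m] = dW.
    apply/seteqP; split=> w Ww m; first by rewrite -(Ww m).
    by have [sw uw] := Ww m; rewrite /W sw uw -surjective_pairing.
  have ddW : determined outcome dW.
    apply: determined_past => v v' /(_ t tT) [cv _] Wv m.
    by have [-> ->] := cv m; exact: Wv.
  rewrite (mean_cond P w_ outcome_rv dA ddW).
  have [PA|PA] := eqVneq (P A) 0%E.
    by rewrite (mean_one P w_ outcome_rv dA) PA !mulr0.
  by congr (_ * _); rewrite (qfw_workers_indep law (fun m => (b m).1) (fun m => (b m).2) tT PA).
- move=> m w Aw; rewrite /worker_error /phi /=.
  rewrite (gloc_increment Kconv Kx1 fS eta01 run m w tT).
  rewrite (increment_mean_past run m (sample c t m w) (ltnW tT) Aw).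
  by rewrite (increment_mean_past run m [set: 'I_n]%SET (ltnW tT) Aw).
- by move=> m; have [] := worker_error_mean m a.
Qed.

(** The coordinatewise bounds summed: averaging over the workers divides
    their contribution by M. *)
Lemma round_error Vs : (forall m, \sum_a vs m a <= Vs) ->
  E A (fun w => enorm (err t w) ^+ 2) <=
  E A (fun w => enorm (inherited t w) ^+ 2 +
   (M%:R^-1 * (Vs + d%:R * (B / (s1 t)%:R) ^+ 2) +
    d%:R * (B / (s2 t)%:R) ^+ 2)).
Proof.
move=> vsV; rewrite meanD mean_cst.
pose b1 := (B / (s1 t)%:R) ^+ 2; pose b2 := (B / (s2 t)%:R) ^+ 2.
have normE (X : Omega -> 'rV[R]_d) :
    E A (fun w => enorm (X w) ^+ 2) = \sum_a E A (fun w => X w 0 a ^+ 2).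
  by rewrite -mean_sum; apply: eq_mean => w _; rewrite enorm_sqr.
rewrite !normE.
apply: le_trans (ler_sum _ (fun a _ => coord_error_mean a)) _.
rewrite big_split /= lerD2l -big_distrl /= ler_wpM2r ?mean_ge0 //.
rewrite big_split /= sumr_const card_ord -[(_ ^+ 2) *+ d]mulr_natl lerD2r.
rewrite -big_distrr exchange_big /=.
apply: le_trans (_ : (M%:R ^+ 2)^-1 * \sum_(m < M) (Vs + d%:R * b1) <= _).
  rewrite ler_wpM2l ?invr_ge0 ?sqr_ge0 //; apply: ler_sum => m _.
  by rewrite big_split /= sumr_const card_ord -[(_ ^+ 2) *+ d]mulr_natl lerD2r.
rewrite sumr_const card_ord -[(_ + _) *+ M]mulr_natl.
rewrite -/b1; set V := Vs + _; rewrite le_eqVlt; apply/orP; left; apply/eqP.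
by field; rewrite pnatr_eq0 -lt0n.
Qed.

End Round.

Lemma sampling_error_full t m a w : sample c t m w = [set: 'I_n]%SET ->
  sampling_error t m a w = 0.
Proof. by move=> sT; rewrite /sampling_error sT subrr mxE. Qed.

Lemma mean_uniform_sample t m w0 (s : nat) (psi : {set 'I_n} -> R) :
  (t < T)%N -> (0 < pos t)%N ->
  sample_size prm (round_index (period prm) t).1 (pos t) = s ->
  E (past c t w0) (fun w => psi (sample c t m w)) =
  'C(n, s)%:R^-1 * (\sum_(S : {set 'I_n} | #|S| == s) psi S) *
    E (past c t w0) (fun=> 1).
Proof.
move=> tT pt sE.
have dA : determined outcome (past c t w0) by exact: past_determined (ltnW tT).
transitivity (\sum_(S : {set 'I_n}) 'C(n, s)%:R^-1 *
    (if #|S| == s then psi S else 0) * E (past c t w0) (fun=> 1)); last first.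
  by rewrite -big_distrl -big_distrr -big_mkcond.
rewrite (mean_partition (sample c t m)); apply: eq_bigr => S _ /=.
rewrite (eq_mean (fun=> psi S)) => [|w [_ <-] //]; rewrite mean_cst.
have -> : past c t w0 `&` sample c t m @^-1` [set S] =
  past c t w0 `&` [set w | sample c t m w = S] by [].
rewrite (mean_cond P w_ outcome_rv dA (sample_determined tT)) mulrA.
have [PA|PA] := eqVneq (P (past c t w0)) 0%E.
  by rewrite (mean_one P w_ outcome_rv dA) PA !mulr0.
congr (_ * _); have := qfw_sample_uniform law m w0 S tT.
case: (round_index _ t) pt sE => i k /= k0 sE /(_ k0 PA) ->.
by rewrite sE; case: ifP; rewrite ?mulr0 // mulrC.
Qed.

Lemma sampling_error_mean t m a w0 (s : nat) : (t < T)%N -> (0 < pos t)%N ->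
  sample_size prm (round_index (period prm) t).1 (pos t) = s ->
  (0 < s <= n)%N ->
  E (past c t w0) (sampling_error t m a) = 0 /\
  E (past c t w0) (fun w => sampling_error t m a w ^+ 2) <=
  (s * n)%:R^-1 * (\sum_j increment f prm q t m j w0 0 a ^+ 2) *
    E (past c t w0) (fun=> 1).
Proof.
move=> tT pt sE /andP[s0 sn].
pose u j := increment f prm q t m j w0 0 a.
pose psi (S : {set 'I_n}) := #|S|%:R^-1 * (\sum_(j in S) u j) -
  n%:R^-1 * \sum_j u j.
have errE w : past c t w0 w -> sampling_error t m a w = psi (sample c t m w).
  move=> pw; rewrite /sampling_error.
  rewrite (increment_mean_past run m (sample c t m w) (ltnW tT) pw).
  rewrite (increment_mean_past run m [set: 'I_n]%SET (ltnW tT) pw).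
  rewrite coordB !mxE !summxE cardsT card_ord; congr (_ - _ * _).
  by apply: eq_bigl => j; rewrite inE.
have C0 : 'C(n, s)%:R != 0 :> R by rewrite pnatr_eq0 -lt0n bin_gt0.
have psiE (S : {set 'I_n}) : #|S| == s ->
  psi S = s%:R^-1 * (\sum_(j in S) u j) - n%:R^-1 * \sum_j u j.
  by move=> /eqP <-.
split.
  rewrite (eq_mean (fun w => psi (sample c t m w)) errE).
  rewrite (mean_uniform_sample _ _ _ tT pt sE) (eq_bigr _ psiE) sumrB.
  rewrite sampling_mean // sumr_const -cardsE card_draws card_ord.
  rewrite -[(_ * _) *+ _]mulr_natl.
  by rewrite subrr mulr0 mul0r.
rewrite (eq_mean (fun w => psi (sample c t m w) ^+ 2)); last first.
  by move=> w /errE ->.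
rewrite (mean_uniform_sample _ _ (fun S => psi S ^+ 2) tT pt sE).
rewrite ler_wpM2r ?mean_ge0 // ler_pdivrMl ?ltr0n ?bin_gt0 //.
rewrite (eq_bigr (fun S : {set 'I_n} =>
    (s%:R^-1 * (\sum_(j in S) u j) - n%:R^-1 * \sum_j u j) ^+ 2)).
  exact: sampling_variance.
by move=> S /psiE ->.
Qed.

End RunLaw.

(** * Convergence rate *)

(** Levels with s^2 = d k absorb the dimension; for d = 0 there is nothing to
    encode. *)
Lemma quantization_noise (R : realType) (d : nat) (B s k : R) : 0 < k ->
  s ^+ 2 = d%:R * k -> d%:R * (B / s) ^+ 2 <= B ^+ 2 / k.
Proof.
move=> k0 s2; have [->|d0] := eqVneq d 0%N.
  by rewrite mul0r divr_ge0 ?sqr_ge0 // ltW.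
rewrite expr_div_n s2 le_eqVlt; apply/orP; left; apply/eqP; field.
by rewrite gt_eqF //= pnatr_eq0.
Qed.

Lemma level_gt0 (R : realType) (d s : nat) (k : R) : 0 < k ->
  s%:R ^+ 2 = d%:R * k -> (0 < d)%N -> (0 < s)%N.
Proof.
move=> k0 sE d0; rewrite lt0n -(pnatr_eq0 R) -sqrf_eq0 sE.
by rewrite mulf_neq0 ?gt_eqF ?ltr0n.
Qed.

Section Rate.
Variables (R : realType) (d M n T : nat).
Variables (disp : measure_display) (Omega : measurableType disp).
Variables (P : probability Omega R).
Variables (K : set 'rV[R]_d) (f : 'I_M -> 'I_n -> 'rV[R]_d -> R).
Variables (L M0 Ginf : R) (prm : qfw_params R) (x1 : 'rV[R]_d).
Variables (c : qfw_choices d M n Omega) (q : qfw_process R d M Omega).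
Variables (o : Omega -> 'I_T) (w_ : Omega).
Hypotheses (M_gt0 : (0 < M)%N) (n_gt0 : (0 < n)%N) (T_gt0 : (0 < T)%N).
Hypotheses (Kconv : convex_set K) (Kcomp : compact K) (Kx1 : K x1).
Hypothesis fS : forall m j, smooth_on K L (f m j).
Hypothesis fM0 : forall m j x, K x -> `|f m j x| <= M0.
Hypothesis fG : forall m j x, K x -> `|grad (f m j) x| <= Ginf.
Hypothesis hperiod : forall i, (period prm i)%:R = Num.sqrt n%:R :> R.
Hypothesis hsize : forall i k, (0 < k < period prm i)%N ->
  (sample_size prm i k)%:R = Num.sqrt n%:R / M%:R :> R.
Hypothesis hstep : forall t, step_size prm t = (Num.sqrt T%:R)^-1.
Hypothesis hlev1_first : forall i,
  (level1 prm i 0)%:R = Num.sqrt (T%:R * d%:R / M%:R) :> R.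
Hypothesis hlev2_first : forall i,
  (level2 prm i 0)%:R = Num.sqrt (T%:R * d%:R) :> R.
Hypothesis hlev1 : forall i k, (0 < k < period prm i)%N ->
  (level1 prm i k)%:R =
    Num.sqrt d%:R * n%:R `^ (4%:R^-1) / Num.sqrt M%:R :> R.
Hypothesis hlev2 : forall i k, (0 < k < period prm i)%N ->
  (level2 prm i k)%:R = Num.sqrt d%:R * n%:R `^ (4%:R^-1) :> R.
Hypothesis run : qfw_run prm K f T x1 c q.
Hypothesis law : qfw_law P prm T c q.
Hypothesis full_sample : forall t m w, (t < T)%N ->
  (round_index (period prm) t).2 = 0%N -> sample c t m w = [set: 'I_n]%SET.
Hypothesis o_unif : uniform_index P c o.

Local Notation x := (iter_pt q).
Local Notation pos t := (round_index (period prm) t).2.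
Local Notation s1 t := (level1 prm (round_index (period prm) t).1 (pos t)).
Local Notation s2 t := (level2 prm (round_index (period prm) t).1 (pos t)).
Local Notation F := (objective f).
Local Notation err := (grad_error f q).
Local Notation inherited := (inherited_error f prm q).
Local Notation E := (mean P (outcome c o) w_).
Local Notation D := (diameter K).
Local Notation eta := ((Num.sqrt T%:R)^-1 : R).
Local Notation rn := (Num.sqrt n%:R : R).

Let T0 : 0 < T%:R :> R. Proof. by rewrite ltr0n. Qed.
Let Mr0 : 0 < M%:R :> R. Proof. by rewrite ltr0n. Qed.
Let n0 : 0 < n%:R :> R. Proof. by rewrite ltr0n. Qed.
Let rn0 : 0 < rn. Proof. by rewrite sqrtr_gt0. Qed.
Let eta0 : 0 < eta. Proof. by rewrite invr_gt0 sqrtr_gt0. Qed.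
Let eta2 : eta ^+ 2 = T%:R^-1. Proof. by rewrite exprVn sqr_sqrtr ?ltW. Qed.
Let D0 : 0 <= D. Proof. exact: diameter_ge0 Kcomp Kx1. Qed.
Let m0 : 'I_M := Ordinal M_gt0.
Let j0 : 'I_n := Ordinal n_gt0.
Let G0 : 0 <= Ginf. Proof. exact: le_trans (fG m0 j0 Kx1). Qed.
Let o_rv : discrete_rv o. Proof. by have [] := o_unif. Qed.

Let eta01 t : 0 <= step_size prm t <= 1.
Proof.
rewrite hstep (ltW eta0) invf_le1 ?sqrtr_gt0 // -[leLHS]sqrtr1 ler_wsqrtr //.
by rewrite ler1n.
Qed.

Let iterK t w : (t <= T)%N -> K (x t w).
Proof. exact: (iter_pt_in Kconv Kx1 eta01 run). Qed.

Let mean_total_cst k : E setT (fun=> k) = k.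
Proof. by rewrite mean_cst (mean_mass1 P w_ (outcome_rv law o_rv)) mulr1. Qed.

Let pos_period t : (pos t < period prm (round_index (period prm) t).1)%N.
Proof.
apply: round_index_pos_lt => i; rewrite -(ltr_nat R) hperiod; exact: rn0.
Qed.

(** At the head of a period the workers use all their functions, so only the
    two roundings contribute, each at most Ginf^2 / T. *)
Lemma first_period_error t : (t < T)%N -> pos t = 0%N ->
  E setT (fun w => enorm (err t w) ^+ 2) <= 2 * Ginf ^+ 2 / T%:R.
Proof.
move=> tT pt.
have incG m j w : `|increment f prm q t m j w| <= Ginf.
  by rewrite /increment pt; apply: fG; exact: iterK (ltnW tT).
have s1E : (s1 t)%:R ^+ 2 = d%:R * (T%:R / M%:R) :> R.
  rewrite pt hlev1_first sqr_sqrtr ?divr_ge0 ?mulr_ge0 ?(ltW T0) ?(ltW Mr0) //.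
  by rewrite mulrCA mulrA.
have s2E : (s2 t)%:R ^+ 2 = d%:R * T%:R :> R.
  by rewrite pt hlev2_first sqr_sqrtr ?mulr_ge0 ?(ltW T0) // mulrC.
have TM0 : 0 < T%:R / M%:R :> R by rewrite divr_gt0.
have s1_gt0 := level_gt0 TM0 s1E; have s2_gt0 := level_gt0 T0 s2E.
rewrite -[leRHS]mean_total_cst.
apply: (mean_pasts (ltnW tT)) => w0.
have exact_sample m a w : sampling_error f prm c q t m a w = 0.
  by apply: sampling_error_full; exact: full_sample.
apply: le_trans (round_error (vs := fun _ _ => 0) (Vs := 0) M_gt0 Kconv Kx1 fS
  eta01 run law o_rv tT G0 incG s1_gt0 s2_gt0 _ _ _) _.
- move=> m a; rewrite (eq_mean (fun=> 0)) => [|w _]; last exact: exact_sample.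
  by rewrite mean_cst mul0r.
- move=> m a; rewrite (eq_mean (fun=> 0)) => [|w _]; last by rewrite exact_sample expr0n.
  by rewrite mean_cst !mul0r.
- by move=> m; rewrite sumr_const mul0rn.
apply: ler_mean => w _ /=; rewrite enorm_sqr big1 => [|a _]; last first.
  by rewrite /inherited_error pt eqxx mxE expr0n.
rewrite !add0r; have b1 := quantization_noise Ginf TM0 s1E.
have b2 := quantization_noise Ginf T0 s2E.
have {}b1 : M%:R^-1 * (d%:R * (Ginf / (s1 t)%:R) ^+ 2) <= Ginf ^+ 2 / T%:R.
  rewrite ler_pdivrMl // (le_trans b1) // le_eqVlt; apply/orP; left; apply/eqP.
  by field; rewrite !gt_eqF.
apply: le_trans (lerD b1 b2) _.
rewrite le_eqVlt; apply/orP; left; apply/eqP; ring.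
Qed.

(** Consecutive iterates are at distance at most D eta. *)
Lemma increment_late t m j w : (t < T)%N -> (0 < pos t)%N ->
  enorm (increment f prm q t m j w) <= `|L| * (D * eta).
Proof.
case: t => [//|u] tT pt; rewrite /increment gtn_eqF //=.
have uT := ltnW tT; have [_ fL] := fS m j.
apply: le_trans (fL _ _ (iterK _ (ltnW tT)) (iterK _ (ltnW uT))) _.
apply: le_trans (ler_wpM2r (enorm_ge0 _) (ler_norm L)) _.
rewrite ler_wpM2l // (qfw_step run w uT) addrAC subrr add0r enormZ hstep.
rewrite gtr0_norm // mulrC ler_wpM2r ?(ltW eta0) //.
apply: le_diameter => //; last exact: iterK (ltnW uT).
exact: (qfw_lmo_in run).
Qed.

Lemma level_late (s : nat) : s%:R = Num.sqrt d%:R * n%:R `^ (4%:R^-1) :> R ->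
  s%:R ^+ 2 = d%:R * rn :> R.
Proof.
move=> ->; rewrite exprMn sqr_sqrtr // -powR_mulrn ?powR_ge0 // -powRrM.
by rewrite -powR12_sqrt // (_ : 4%:R^-1 * 2%:R = 2^-1) //; field.
Qed.

(** Sampling and the two roundings contribute L^2 D^2 / (T sqrt n) each. *)
Lemma late_error t : (t < T)%N -> (0 < pos t)%N ->
  E setT (fun w => enorm (err t w) ^+ 2) <=
  E setT (fun w => enorm (err t.-1 w) ^+ 2) +
    3 * L ^+ 2 * D ^+ 2 / (T%:R * rn).
Proof.
move=> tT pt; set i := (round_index (period prm) t).1.
have kp : (0 < pos t < period prm i)%N by rewrite pt pos_period.
have s1E : (s1 t)%:R ^+ 2 = d%:R * (rn / M%:R) :> R.
  rewrite (hlev1 kp) expr_div_n sqr_sqrtr ?(ltW Mr0) // -(hlev2 kp).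
  by rewrite (level_late (hlev2 kp)) mulrA.
have s2E := level_late (hlev2 kp); rewrite -/i in s2E.
have rM0 : 0 < rn / M%:R by rewrite divr_gt0.
have s1_gt0 := level_gt0 rM0 s1E; have s2_gt0 := level_gt0 rn0 s2E.
set s := sample_size prm i (pos t).
have sE : s%:R = rn / M%:R :> R := hsize kp.
have s0 : (0 < s)%N by rewrite -(ltr_nat R) sE.
have sn : (s <= n)%N.
  rewrite -(ler_nat R) sE ler_pdivrMr //.
  apply: (@le_trans _ _ (n%:R * 1)); last by rewrite ler_wpM2l // ler1n.
  rewrite mulr1 -[leRHS]sqr_sqrtr // expr2 ler_peMl // -[leLHS]sqrtr1.
  by rewrite ler_wsqrtr // ler1n.
pose B := `|L| * (D * eta).
have B0 : 0 <= B by rewrite !mulr_ge0 // ltW.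
have B2 : B ^+ 2 = L ^+ 2 * D ^+ 2 / T%:R.
  by rewrite /B !exprMn real_normK ?num_real // eta2 mulrA.
have incB m j w : `|increment f prm q t m j w| <= B.
  exact: le_trans (norm_le_enorm _) (increment_late _ _ _ tT pt).
apply: le_trans (_ : E setT (fun w => enorm (err t.-1 w) ^+ 2 +
    3 * L ^+ 2 * D ^+ 2 / (T%:R * rn)) <= _); last first.
  by rewrite meanD mean_total_cst.
apply: (mean_pasts (ltnW tT)) => w0.
have sn0 : (0 < s <= n)%N by rewrite s0.
apply: le_trans (round_error (vs := fun m a => (s * n)%:R^-1 *
    \sum_j increment f prm q t m j w0 0 a ^+ 2) (Vs := B ^+ 2 / s%:R)
  M_gt0 Kconv Kx1 fS eta01 run law o_rv tT B0 incB s1_gt0 s2_gt0 _ _ _) _.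
- by move=> m a; have [] := sampling_error_mean w_ run law o_rv m a w0 tT pt erefl sn0.
- by move=> m a; have [] := sampling_error_mean w_ run law o_rv m a w0 tT pt erefl sn0.
- move=> m; rewrite -big_distrr exchange_big /=.
  under eq_bigr do rewrite -enorm_sqr.
  apply: le_trans (_ : (s * n)%:R^-1 * \sum_(j < n) B ^+ 2 <= _).
    rewrite ler_wpM2l ?invr_ge0 //; apply: ler_sum => j _.
    by rewrite ler_sqr ?nnegrE ?enorm_ge0 // increment_late.
  rewrite sumr_const card_ord -(mulr_natl _ n) natrM le_eqVlt.
  apply/orP; left; apply/eqP; field.
  by rewrite !pnatr_eq0 -!lt0n n_gt0 s0.
apply: ler_mean => w _ /=; rewrite /inherited_error gtn_eqF // lerD2l.
have b1 := quantization_noise B rM0 s1E; have b2 := quantization_noise B rn0 s2E.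
have -> : 3 * L ^+ 2 * D ^+ 2 / (T%:R * rn) = M%:R^-1 * (B ^+ 2 / s%:R +
    B ^+ 2 / (rn / M%:R)) + B ^+ 2 / rn.
  by rewrite B2 sE; field; rewrite !gt_eqF.
by rewrite lerD // ler_wpM2l ?invr_ge0 ?(ltW Mr0) // lerD2l.
Qed.

(** A period has sqrt n rounds, so the cost of its later rounds adds up to
    at most 3 L^2 D^2 / T. *)
Lemma error_second_moment t : (t < T)%N ->
  E setT (fun w => enorm (err t w) ^+ 2) <=
  (3 * L ^+ 2 * D ^+ 2 + 2 * Ginf ^+ 2) / T%:R.
Proof.
move=> tT.
(* The error at position pos t of its period: the head, then pos t increments. *)
suff : E setT (fun w => enorm (err t w) ^+ 2) <=
    2 * Ginf ^+ 2 / T%:R + (pos t)%:R * (3 * L ^+ 2 * D ^+ 2 / (T%:R * rn)).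
  move=> /le_trans; apply.
  have pr : (pos t)%:R <= rn.
    by rewrite -(hperiod (round_index (period prm) t).1) ler_nat ltnW ?pos_period.
  apply: le_trans (_ : 2 * Ginf ^+ 2 / T%:R +
      rn * (3 * L ^+ 2 * D ^+ 2 / (T%:R * rn)) <= _).
    rewrite lerD2l ler_wpM2r // -[3 * _ * _]mulrA -exprMn.
    by apply: divr_ge0; apply: mulr_ge0; rewrite ?sqr_ge0 ?sqrtr_ge0.
  rewrite le_eqVlt; apply/orP; left; apply/eqP; field.
  by rewrite !gt_eqF.
move: {2}(pos t) (erefl (pos t)) => k; elim: k t tT => [|k IHk] t tT pt.
  by rewrite pt mul0r addr0; exact: first_period_error.
have [u tu pu] := round_index_pred pt; rewrite {t}tu in tT pt *.
apply: le_trans (late_error tT _) _; first by rewrite pt.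
apply: le_trans (lerD (IHk u (ltnW tT) pu) (lexx _)) _.
by rewrite pu pt -[k.+1%:R]natr1 [(k%:R + 1) * _]mulrDl mul1r addrA.
Qed.

(** For u in K, optimality of the vertex v for the estimator gives
    <x - u, grad> <= <x - v, grad> + <u - v, e>; the first term is bounded by the
    descent inequality along v - x, the second by D |e|. *)
Lemma fw_progress t w : (t < T)%N ->
  fw_gap K F (x t w) <= eta^-1 * (F (x t w) - F (x t.+1 w)) +
    D * enorm (err t w) + L * D ^+ 2 / 2 * eta.
Proof.
move=> tT; have Kx := iterK w (ltnW tT).
have Kv : K (lmo q t w) := qfw_lmo_in run _ tT.
set v := lmo q t w in Kv *; set y := x t w in Kx *.
apply: ge_sup; first by exists (dotp (y - y) (- grad F y)), y.
move=> _ [u Ku <-].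
have Kx' : K (x t.+1 w) := iterK w tT.
have := objective_descent M_gt0 n_gt0 Kconv fS Kx Kx'.
rewrite (qfw_step run w tT) -/y -/v hstep.
rewrite (_ : y + eta *: (v - y) - y = eta *: (v - y)); last first.
  by rewrite addrAC subrr add0r.
rewrite dotpC dotpZl enormZ exprMn gtr0_norm // => desc.
have opt : dotp v (gbar q t w) <= dotp u (gbar q t w) := qfw_lmo_min run w tT Ku.
have cs : dotp (v - u) (- err t w) <= D * enorm (err t w).
  apply: le_trans (cauchy_schwarz _ _) _.
  by rewrite -[- err t w]scaleN1r enormZ normrN1 mul1r ler_wpM2r ?enorm_ge0 // le_diameter.
have curv : L * enorm (v - y) ^+ 2 <= L * D ^+ 2.
  exact: smooth_le_diameter Kcomp (fS m0 j0) Kv Kx.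
have gapE : dotp (u - y) (- grad F y) =
    dotp (v - u) (- err t w) + (dotp v (gbar q t w) - dotp u (gbar q t w)) -
    dotp (v - y) (grad F y).
  by rewrite /grad_error -/y !dotpNr !dotpBl !dotpDr !dotpNr; ring.
rewrite gapE; set y' := y + _ in desc *.
have dE : dotp (v - y) (grad F y) >= eta^-1 * (F y' - F y) - L * D ^+ 2 / 2 * eta.
  have lq : L / 2 * (eta ^+ 2 * enorm (v - y) ^+ 2) <= L * D ^+ 2 / 2 * eta ^+ 2.
    have -> : L / 2 * (eta ^+ 2 * enorm (v - y) ^+ 2) =
      L * enorm (v - y) ^+ 2 * (2^-1 * eta ^+ 2) by ring.
    have -> : L * D ^+ 2 / 2 * eta ^+ 2 = L * D ^+ 2 * (2^-1 * eta ^+ 2) by ring.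
    by rewrite ler_wpM2r // mulr_ge0 ?sqr_ge0.
  have -> : eta^-1 * (F y' - F y) - L * D ^+ 2 / 2 * eta =
      eta^-1 * (F y' - F y - L * D ^+ 2 / 2 * eta ^+ 2).
    by field; rewrite gt_eqF // sqrtr_gt0.
  by rewrite ler_pdivrMl //; lra.
lra.
Qed.

Lemma objective_bound y : K y -> `|F y| <= M0.
Proof.
move=> Ky; rewrite /objective normrM normfV normr_nat natrM.
rewrite ler_pdivrMl ?mulr_gt0 // (le_trans (ler_norm_sum _ _ _)) //.
apply: le_trans (_ : \sum_(m < M) \sum_(j < n) M0 <= _).
  apply: ler_sum => m _; rewrite (le_trans (ler_norm_sum _ _ _)) //.
  by apply: ler_sum => j _; exact: fM0.
by rewrite !sumr_const !card_ord -mulrA !mulr_natl lexx.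
Qed.

(** The index is uniform given the whole run. *)
Lemma mean_random_index (X : 'I_T -> Omega -> R) :
  (forall j w w', past c T w w' -> X j w = X j w') ->
  E setT (fun w => X (o w) w) = T%:R^-1 * E setT (fun w => \sum_j X j w).
Proof.
move=> Xp; rewrite mean_sum big_distrr (mean_partition o); apply: eq_bigr => j _ /=.
rewrite (eq_mean (X j)) => [|w [_ <-] //].
rewrite !(mean_partition (history c T)) big_distrr /=; apply: eq_bigr => h _.
have [[w0 hw0]|h0] := pselect (exists w0, history c T w0 = h); last first.
  have no (A : set Omega) : (forall w, ~ A w) -> E A (X j) = 0.
    move=> A0; rewrite (eq_mean (fun=> 0)) => [|w /A0 //].
    by rewrite mean_cst mul0r.
  by rewrite !no ?mulr0 // => w [_ hw]; apply: h0; exists w.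
have pE : history c T @^-1` [set h] = past c T w0.
  apply/seteqP; split=> w; first by move=> /= hw; apply/historyP; rewrite hw.
  by move=> /historyP /= ->.
rewrite !setTI pE setIC.
have XE (A : set Omega) : A `<=` past c T w0 -> E A (X j) = X j w0 * E A (fun=> 1).
  move=> AP; rewrite -mean_cst; apply: eq_mean => w /AP pw.
  by rewrite -(Xp j w0 w pw).
rewrite !XE //.
have dP : determined (outcome c o) (past c T w0) by exact: past_determined.
have d_o : determined (outcome c o) [set w | o w = j].
  by move=> w w' [_ /= ->].
have := mean_cond P w_ (outcome_rv law o_rv) dP d_o.
rewrite (_ : [set w | o w = j] = o @^-1` [set j]) // => ->.
have [PA|PA] := eqVneq (P (past c T w0)) 0%E.
  by rewrite (mean_one P w_ (outcome_rv law o_rv) dP) PA !mulr0.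
have [_ /(_ w0 j PA)] := o_unif; rewrite (_ : [set w | o w = j] = o @^-1` [set j]) // => ->.
by rewrite mulrCA.
Qed.

(** The decreases of the objective telescope. *)
Lemma gap_sum w : \sum_(t < T) fw_gap K F (x t w) <=
  eta^-1 * (2 * M0) + D * (\sum_(t < T) enorm (err t w)) +
  T%:R * (L * D ^+ 2 / 2 * eta).
Proof.
apply: le_trans (ler_sum _ (fun (t : 'I_T) _ => fw_progress w (ltn_ord t))) _.
rewrite !big_split /= -!big_distrr /= sumr_const card_ord -(mulr_natl eta).
rewrite [T%:R * (_ * eta)]mulrCA !lerD2r ler_wpM2l ?invr_ge0 ?(ltW eta0) //.
have -> : \sum_(t < T) (F (x t w) - F (x t.+1 w)) = F (x 0%N w) - F (x T w).
  rewrite -(big_mkord xpredT (fun t => F (x t w) - F (x t.+1 w))).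
  rewrite (eq_bigr (fun t => (- F (x t.+1 w)) - (- F (x t w)))) => [|t _].
    by rewrite (telescope_sumr (fun t => - F (x t w))) // opprK addrC.
  by rewrite opprK addrC.
have /ler_normlP[_ F0] := objective_bound (iterK w (leq0n T)).
have /ler_normlP[FT _] := objective_bound (iterK w (leqnn T)).
lra.
Qed.

Lemma mean_gap_bound :
  E setT (fun w => fw_gap K F (x (o w) w)) <=
  (2 * M0 + D * Num.sqrt (3 * L ^+ 2 * D ^+ 2 + 2 * Ginf ^+ 2)
      + L * D ^+ 2 / 2) / Num.sqrt T%:R.
Proof.
rewrite (mean_random_index (X := fun t w => fw_gap K F (x t w))); last first.
  move=> t w w' ww'; congr (fw_gap K F _); apply/esym.
  by apply: (iter_past run (ltnW (ltn_ord t))); exact: past_le (ltnW (ltn_ord t)) ww'.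
set W := 3 * L ^+ 2 * D ^+ 2 + 2 * Ginf ^+ 2.
have W0 : 0 <= W.
  rewrite /W -[3 * _ * _]mulrA -exprMn.
  by apply: addr_ge0; apply: mulr_ge0; rewrite ?sqr_ge0.
have errS (t : 'I_T) : E setT (fun w => enorm (err t w)) <= Num.sqrt W * eta.
  have -> : Num.sqrt W * eta = Num.sqrt (W / T%:R).
    by rewrite sqrtrM // sqrtrV // ltW.
  apply: (mean_le_sqrt (outcome_rv law o_rv)).
  exact: error_second_moment.
apply: le_trans (_ : T%:R^-1 * (eta^-1 * (2 * M0) +
   D * (\sum_(t < T) Num.sqrt W * eta) + T%:R * (L * D ^+ 2 / 2 * eta)) <= _).
  rewrite ler_wpM2l ?invr_ge0 ?(ltW T0) //.
  apply: le_trans (_ : E setT (fun w => eta^-1 * (2 * M0) +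
      D * (\sum_(t < T) enorm (err t w)) + T%:R * (L * D ^+ 2 / 2 * eta)) <= _).
    by apply: ler_mean => w _; exact: gap_sum.
  rewrite !meanD !mean_total_cst meanZ mean_sum lerD2r lerD2l ler_wpM2l //.
  exact: ler_sum.
rewrite sumr_const card_ord -[(_ * eta) *+ T]mulr_natl.
have T_eta : T%:R = (eta ^+ 2)^-1 by rewrite eta2 invrK.
rewrite le_eqVlt; apply/orP; left; apply/eqP.
move: T_eta eta0; move: eta => e Te e0; rewrite Te.
by field; rewrite gt_eqF.
Qed.

End Rate.

Theorem theorem7 (R : realType) (d M n T : nat)
  (hM : (0 < M)%N) (hn : (0 < n)%N) (hT : (0 < T)%N)
  (K : set 'rV[R]_d) (hKconv : convex_set K) (hKcomp : compact K)
  (f : 'I_M -> 'I_n -> 'rV[R]_d -> R) (L M0 Ginf : R)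
  (hsmooth : forall m j, smooth_on K L (f m j))
  (hbound : forall m j, (ereal_sup [set `|f m j x|%:E | x in K] <= M0%:E)%E)
  (hgrad : forall m j x, K x -> `|grad (f m j) x| <= Ginf)
  (prm : qfw_params R)
  (hperiod : forall i, (period prm i)%:R = Num.sqrt n%:R :> R)
  (hsize : forall i k, (0 < k < period prm i)%N ->
    (sample_size prm i k)%:R = Num.sqrt n%:R / M%:R :> R)
  (hstep : forall t, step_size prm t = (Num.sqrt T%:R)^-1)
  (hlev1_first : forall i,
    (level1 prm i 0)%:R = Num.sqrt (T%:R * d%:R / M%:R) :> R)
  (hlev2_first : forall i,
    (level2 prm i 0)%:R = Num.sqrt (T%:R * d%:R) :> R)
  (hlev1 : forall i k, (0 < k < period prm i)%N ->
    (level1 prm i k)%:R =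
      Num.sqrt d%:R * n%:R `^ (4%:R^-1) / Num.sqrt M%:R :> R)
  (hlev2 : forall i k, (0 < k < period prm i)%N ->
    (level2 prm i k)%:R = Num.sqrt d%:R * n%:R `^ (4%:R^-1) :> R)
  (disp : measure_display) (Omega : measurableType disp)
  (P : probability Omega R)
  (x1 : 'rV[R]_d) (hx1 : K x1)
  (c : qfw_choices d M n Omega) (q : qfw_process R d M Omega)
  (hrun : qfw_run prm K f T x1 c q)
  (hlaw : qfw_law P prm T c q)
  (hfirst : forall t m w, (t < T)%N ->
    (round_index (period prm) t).2 = 0%N -> sample c t m w = [set: 'I_n]%SET)
  (o : Omega -> 'I_T) (ho : uniform_index P c o) :
  let D := diameter K in
  let xo := fun w => iter_pt q (o w) w in
  (forall w, K (xo w)) /\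
  ('E_P[fun w => fw_gap K (objective f) (xo w)] <=
    ((2 * M0 + D * Num.sqrt (3 * L ^+ 2 * D ^+ 2 + 2 * Ginf ^+ 2)
      + L * D ^+ 2 / 2) / Num.sqrt T%:R)%:E)%E.
Proof.
have hstep01 t : 0 <= step_size prm t <= 1.
  rewrite hstep invr_ge0 sqrtr_ge0 invf_le1 ?sqrtr_gt0 ?ltr0n //.
  by rewrite -[leLHS]sqrtr1 ler_wsqrtr // ler1n.
split=> [w|]; first exact: (iter_pt_in hKconv hx1 hstep01 hrun _ (ltnW (ltn_ord (o w)))).
have fM0 m j y : K y -> `|f m j y| <= M0.
  move=> Ky; rewrite -lee_fin; apply: le_trans (hbound m j).
  by apply: ereal_sup_ubound; exists y.
(* A probability space is not empty. *)
have [w_ _] : exists w : Omega, True.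
  have [//|no] := pselect (exists w : Omega, True).
  have := @probability_setT _ _ _ P; rewrite (_ : setT = set0) ?measure0.
    by move=> /eqP; rewrite eq_sym onee_eq0.
  by apply/seteqP; split=> // w _; apply: no; exists w.
have o_rv : discrete_rv o by have [] := ho.
rewrite (expectation_mean P w_ (outcome_rv hlaw o_rv)).
  rewrite lee_fin; exact: (mean_gap_bound w_ hM hn hT hKconv hKcomp hx1 hsmooth
    fM0 hgrad hperiod hsize hstep hlev1_first hlev2_first hlev1 hlev2 hrun hlaw
    hfirst ho).
move=> w w' [hw ow]; congr (fw_gap K _ _); rewrite ow.
apply: (iter_past hrun (ltnW (ltn_ord (o w')))).
by apply: past_le (ltnW (ltn_ord (o w'))) _; exact/historyP.
Qed.
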